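(* Let $K$ be a field of characteristic zero and let $A\subseteq K[x_1,\ldots,x_d]$ be a principal Borel-fixed algebra. Then the Gauss algebra $\mathbb{G}(A)$ is normal, and for a suitable monomial order its defining ideal has a quadratic Gröbner basis.
   Context: Borel sets: a finite set $G$ of monomials of the same degree in $S=K[x_1,\ldots,x_d]$ is a Borel set if the monomial ideal generated by $G$ is fixed under all linear automorphisms of $S$ given by nonsingular upper triangular matrices; since $\mathrm{char}(K)=0$, this is equivalent to: for every $u\in G$ and all $i<j$ such that $x_j$ divides $u$, one has $x_i(u/x_j)\in G$. A Borel set is principal if it is the smallest Borel set $\langle u\rangle$ containing some monomial $u$. Borel-fixed algebra: for a Borel set $G\subset S$, the $K$-subalgebra $A=K[G]$ of $S$ is a Borel-fixed algebra if $\dim A=d$; it is principal if $G$ is a principal Borel set. Gauss algebra: if $A=K[g_1,\ldots,g_n]\subseteq S$ is generated by homogeneous polynomials of the same degree and $\dim A=d$, then $\mathbb{G}(A)$ is the $K$-subalgebra of $S$ generated by the $d\times d$ minors of the Jacobian matrix of $g_1,\ldots,g_n$. If the $g_i$ are monomials, then $\mathbb{G}(A)$ is generated by the monomials $(g_{i_1}\cdots g_{i_d})/(x_1\cdots x_d)$ for which the matrix of exponent vectors of $g_{i_1},\ldots,g_{i_d}$ has nonzero determinant. The defining ideal of $\mathbb{G}(A)$ is the kernel of the $K$-algebra homomorphism $K[y_u : u\in G']\to \mathbb{G}(A)$, $y_u\mapsto u$, where $G'$ is the set of these monomial generators of $\mathbb{G}(A)$.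
   Formalization: When the Gauss algebra is K (its only monomial generator is 1, e.g. A = K[x_1,…,x_d]), the defining ideal is (y−1), which has no Gröbner basis of quadrics; there ''quadratic'' is read as degree at most two, elsewhere as homogeneous of degree exactly two. *)

(* Defs.v *)
From HB Require Import structures.
From mathcomp Require Import all_boot all_order all_algebra.
From mathcomp Require Import finmap.
From mathcomp Require Import mpoly.

Set Implicit Arguments.
Unset Strict Implicit.
Unset Printing Implicit Defensive.

Import GRing.Theory.

Local Open Scope ring_scope.

(** Ideals and subalgebras are (possibly undecidable) subsets, encoded as
    Prop-valued predicates on the carrier. *)

Section Subsets.
Variables (K : fieldType) (S : comAlgType K).
Implicit Types (A I X : S -> Prop).

Definition subalgebra A : Prop :=
  [/\ forall c : K, A c%:A,
      forall x y, A x -> A y -> A (x + y)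
    & forall x y, A x -> A y -> A (x * y)].

Definition generated_subalgebra X (x : S) : Prop :=
  forall A, subalgebra A -> (forall y, X y -> A y) -> A x.

Definition generated_ideal X (x : S) : Prop :=
  exists (n : nat) (c g : 'I_n -> S),
    (forall i, X (g i)) /\ x = \sum_(i < n) c i * g i.

(* [A] is meant to be a subring of [S]; [I] is an ideal of [A], not of [S]. *)
Definition ideal_of A I : Prop :=
  [/\ forall x, I x -> A x,
      I 0,
      forall x y, I x -> I y -> I (x + y)
    & forall a x, A a -> I x -> I (a * x)].

Definition prime_ideal_of A (P : S -> Prop) : Prop :=
  [/\ ideal_of A P, ~ P 1
    & forall a b, A a -> A b -> P (a * b) -> P a \/ P b].

(* A strict chain P_0 < P_1 < ... < P_n of prime ideals of [A]. *)
Definition prime_chain A (n : nat) (P : nat -> S -> Prop) : Prop :=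
  (forall i, (i <= n)%N -> prime_ideal_of A (P i)) /\
  (forall i, (i < n)%N ->
     (forall x, P i x -> P i.+1 x) /\ (exists x, P i.+1 x /\ ~ P i x)).

Definition krull_dim A (n : nat) : Prop :=
  (exists P, prime_chain A n P) /\
  (forall m P, prime_chain A m P -> (m <= n)%N).

End Subsets.

(** [A] is integrally closed in its field of fractions; the latter is realised
    inside the field of fractions of the ambient domain [S]. *)
Definition normal_subring (S : idomainType) (A : S -> Prop) : Prop :=
  forall a b : S, A a -> A b -> b != 0 ->
    (exists p : {poly S},
       [/\ p \is monic, forall i : nat, A p`_i
         & root (map_poly (@tofrac S) p) (tofrac a / tofrac b)]) ->
    exists2 c, A c & tofrac c = tofrac a / tofrac b.

(** Borel sets *)

Section Borel.
Variables (K : fieldType) (d : nat).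
Local Notation S := {mpoly K[d]}.
Implicit Types G : {fset 'X_{1..d}}.

(* The substitution x_j |-> \sum_i M i j * x_i; when [M] is upper triangular,
   x_j goes to a combination of x_1, ..., x_j. *)
Definition linear_subst (M : 'M[K]_d) (f : S) : S :=
  f \mPo [tuple \sum_(i < d) M i j *: 'X_i | j < d].

Definition upper_triangular (M : 'M[K]_d) : Prop :=
  forall i j : 'I_d, (j < i)%N -> M i j = 0.

Definition monomials_of G (f : S) : Prop := exists2 m, m \in G & f = 'X_[m].

Definition borel_set G : Prop :=
  (forall m m', m \in G -> m' \in G -> mdeg m = mdeg m') /\
  (forall M : 'M[K]_d, M \in unitmx -> upper_triangular M ->
     forall f : S, generated_ideal (monomials_of G) f <->
       exists2 g, generated_ideal (monomials_of G) g & f = linear_subst M g).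

Definition principal_borel_set G : Prop :=
  exists u : 'X_{1..d},
    [/\ borel_set G, u \in G
      & forall H, borel_set H -> u \in H -> (G `<=` H)%fset].

Definition monomial_algebra G : S -> Prop :=
  generated_subalgebra (monomials_of G).

Definition principal_borel_fixed_algebra G (A : S -> Prop) : Prop :=
  [/\ principal_borel_set G,
      forall f, A f <-> monomial_algebra G f
    & krull_dim A d].

End Borel.

(** Gauss algebras *)

Section Gauss.
Variables (K : fieldType) (d : nat).
Local Notation S := {mpoly K[d]}.

Definition jacobian n (g : 'I_n -> S) : 'M[S]_(n, d) :=
  \matrix_(i < n, j < d) mderiv j (g i).

(* The d x d minors: [s] selects d distinct rows; listing them in another
   order only changes the sign of the minor. *)
Definition jacobian_minor n (g : 'I_n -> S) (f : S) : Prop :=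
  exists2 s : 'I_d -> 'I_n, injective s & f = \det (rowsub s (jacobian g)).

Definition gauss_algebra n (g : 'I_n -> S) : S -> Prop :=
  generated_subalgebra (jacobian_minor g).

End Gauss.

Section GaussMonomial.
Variable d : nat.
Implicit Types G : {fset 'X_{1..d}}.

(* An enumeration of [G]; the default value is never reached. *)
Definition enum_mon G (i : 'I_#|` G|) : 'X_{1..d} := nth 0%MM (enum_fset G) i.

Definition exponent_matrix G (s : {ffun 'I_d -> 'I_#|` G|}) : 'M[int]_d :=
  \matrix_(i < d, j < d) (enum_mon (s i) j)%:Z.

(* (g_{s 1} ... g_{s d}) / (x_1 ... x_d).  The truncated subtraction is exact
   when \det (exponent_matrix s) != 0: the determinant then has a nonzero term,
   so every variable divides the product. *)
Definition gauss_monomial G (s : {ffun 'I_d -> 'I_#|` G|}) : 'X_{1..d} :=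
  [multinom ((\sum_(i < d) enum_mon (s i) j) - 1)%N | j < d].

Definition gauss_monomials G : {fset 'X_{1..d}} :=
  [fset gauss_monomial s | s : {ffun 'I_d -> 'I_#|` G|}
                           in [pred s | \det (exponent_matrix s) != 0]]%fset.

End GaussMonomial.

(* The kernel of K[y_u : u in G] -> K[x_1, ..., x_d], y_u |-> u. *)
Definition toric_ideal (K : fieldType) (d : nat) (G : {fset 'X_{1..d}})
    (f : {mpoly K[#|` G|]}) : Prop :=
  f \mPo [tuple 'X_[K, enum_mon i] | i < #|` G|] = 0.

(** Groebner bases *)

Section Groebner.
Variables (K : fieldType) (n : nat).
Local Notation S := {mpoly K[n]}.

(* Well-foundedness is automatic from these axioms (Dickson's lemma). *)
Record monomial_order (le : rel 'X_{1..n}) : Prop := MonomialOrder {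
  mo_refl  : reflexive le;
  mo_anti  : antisymmetric le;
  mo_trans : transitive le;
  mo_total : total le;
  mo_ge0   : forall m, le 0%MM m;
  mo_add   : forall m1 m2 m, le m1 m2 -> le (m1 + m)%MM (m2 + m)%MM
}.

Definition leading_monomial (le : rel 'X_{1..n}) (f : S) (m : 'X_{1..n}) : Prop :=
  m \in msupp f /\ (forall m', m' \in msupp f -> le m' m).

Definition leading_monomials (le : rel 'X_{1..n}) (X : S -> Prop) (f : S) : Prop :=
  exists g m, [/\ X g, leading_monomial le g m & f = 'X_[m]].

Definition groebner_basis (le : rel 'X_{1..n}) (I : S -> Prop) (B : seq S) : Prop :=
  (forall g, g \in B -> I g /\ g != 0) /\
  (forall f, generated_ideal (leading_monomials le I) f <->
             generated_ideal (leading_monomials le (fun g => g \in B)) f).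

End Groebner.

(* Elements of [B] are homogeneous of degree exactly two, unless 1 is one of
   the monomials in [G].  When [G] consists of monomials of one degree, this
   exception means G = {1}: the toric ideal is then (y_1 - 1), which has no
   Groebner basis of quadrics, and "quadratic" means degree at most two. *)
Definition quadratic (K : fieldType) (d : nat) (G : {fset 'X_{1..d}})
    (B : seq {mpoly K[#|` G|]}) : Prop :=
  forall g, g \in B ->
    (msize g <= 3)%N /\ (0%MM \notin G -> g \is 2.-homog).

(* Main.v *)
(** A principal Borel set is cut out by bounds on degree and tails, the tails of a
    monomial being the sums t_k of its exponents of x_k, x_(k+1), ..., x_d.  The
    monomial generators of the Gauss algebra again form such a set.  They are
    closed under the moves x_j -> x_i, i < j: in a nonsingular exponent matrix
    some row can be moved without destroying nonsingularity, by Cramer's rule.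
    They have a greatest element: if G = <u>, a nonzero term of a determinant in
    tail coordinates assigns to each k > 1 its own factor v with
    t_k(v) < t_k(u), so the product is dominated by the one of u and, for each
    k > 1, the largest v in G with t_k(v) < t_k(u).

    For a set H of monomials cut out by bounds on degree and tails, K[H] is
    spanned by the monomials in the cone generated by H (divide tails by the
    degree and round down to split off a factor), and leading monomials show
    that an almost integral fraction lies in K[H].  Replacing the tails s, t of
    two generators by the floor and ceiling of (s + t) / 2 is the sorting
    operator; the sorting relations form a Groebner basis because a product all
    of whose pairs are sorted is determined by its image, and because sorting
    decreases a weight. *)

Require Import Defs.
From mathcomp Require Import all_boot all_order all_algebra.
From mathcomp Require Import finmap.
From mathcomp Require Import mpoly.
From mathcomp Require Import fingroup perm zify.

Set Implicit Arguments.
Unset Strict Implicit.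
Unset Printing Implicit Defensive.

Import Order.TTheory GRing.Theory.

Local Open Scope ring_scope.

(** * Tails of monomials *)

Section Tails.
Variable d : nat.
Implicit Types m : 'X_{1..d}.

Definition tail m (k : nat) : nat := \sum_(j < d | (k <= j)%N) m j.

Lemma tail0 m : tail m 0 = mdeg m.
Proof. by rewrite mdegE; apply: eq_bigl. Qed.

Lemma tail_out m k : (d <= k)%N -> tail m k = 0%N.
Proof.
move=> dk; rewrite /tail big_pred0 // => j.
by rewrite leqNgt (leq_trans (ltn_ord j)).
Qed.

Lemma tailS m (k : 'I_d) : tail m k = (m k + tail m k.+1)%N.
Proof.
rewrite /tail (bigD1 k) //=; congr addn; apply: eq_bigl => j.
by rewrite ltn_neqAle andbC eq_sym.
Qed.

Lemma tail_anti m k l : (k <= l)%N -> (tail m l <= tail m k)%N.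
Proof.
move=> kl; rewrite /tail [leqRHS](bigID (fun j : 'I_d => (l <= j)%N)) /=.
rewrite [X in (_ <= X + _)%N](eq_bigl (fun j : 'I_d => (l <= j)%N)) ?leq_addr //.
by move=> j; apply: andb_idl; apply: leq_trans.
Qed.

Lemma tail0m k : tail 0%MM k = 0%N.
Proof. by rewrite /tail big1 // => j _; rewrite mnm0E. Qed.

Lemma tailD m m' k : tail (m + m')%MM k = (tail m k + tail m' k)%N.
Proof. by rewrite -big_split; apply: eq_bigr => j _; rewrite mnmDE. Qed.

Lemma tailMn m n k : tail (m *+ n)%MM k = (tail m k * n)%N.
Proof. by rewrite big_distrl; apply: eq_bigr => j _; rewrite mulmnE. Qed.

Lemma tail_sum (I : Type) (r : seq I) (P : pred I) (F : I -> 'X_{1..d}) k :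
  tail (\sum_(i <- r | P i) F i)%MM k = (\sum_(i <- r | P i) tail (F i) k)%N.
Proof. by apply: (big_morph (tail^~ k)) => [m m'|]; rewrite ?tailD ?tail0m. Qed.

Lemma tailU (i : 'I_d) k : tail U_(i)%MM k = (k <= i)%N.
Proof.
rewrite /tail; case: leqP => ki.
  rewrite (bigD1 i) //= mnm1E eqxx big1 // => j /andP[_ ji].
  by rewrite mnm1E eq_sym (negPf ji).
rewrite big1 // => j kj; rewrite mnm1E; case: eqP => // ij.
by move: kj; rewrite -ij leqNgt ki.
Qed.

Lemma tail_inj m m' : (forall k, tail m k = tail m' k) -> m = m'.
Proof. by move=> e; apply/mnmP => j; have := tailS m j; rewrite !e tailS; lia. Qed.

(** Inverse to taking tails. The truncated differences are exact for nonincreasing [t], and the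
    tails of the result are [t] if moreover [t] vanishes from [d] on. *)
Definition of_tails (t : nat -> nat) : 'X_{1..d} :=
  [multinom (t j - t j.+1)%N | j < d].

Lemma tail_of_tails t k :
  (forall j, t j.+1 <= t j)%N -> (forall j, d <= j -> t j = 0)%N ->
  tail (of_tails t) k = t k.
Proof.
move=> tS t0; have [dk|kd] := leqP d k; first by rewrite tail_out ?t0.
(* Writing [k = d - i] lets the induction run down from index [d], where both sides vanish. *)
have [i id ->] : exists2 i, (i <= d)%N & k = (d - i)%N by exists (d - k)%N; lia.
clear kd; elim: i id => [|i IH] id; first by rewrite subn0 tail_out ?t0.
have e : (d - i.+1).+1 = (d - i)%N by lia.
have di : (d - i.+1 < d)%N by lia.
have := tailS (of_tails t) (Ordinal di); rewrite /= mnmE /= e => ->.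
have [i0|ip] := posnP i; last by rewrite IH ?subnK -?e //; lia.
by rewrite i0 subn0 tail_out // (t0 d) // subn0 addn0.
Qed.

End Tails.

(** * Borel moves and their effect on tails *)

Section Moves.
Variable d : nat.
Implicit Types (m : 'X_{1..d}) (H : {fset 'X_{1..d}}).

Definition move (i j : 'I_d) m : 'X_{1..d} := (m - U_(j) + U_(i))%MM.

Definition move_closed H : Prop := forall m (i j : 'I_d),
  m \in H -> (i < j)%N -> (0 < m j)%N -> move i j m \in H.

Lemma move_add (i j : 'I_d) m : (0 < m j)%N -> (move i j m + U_(j) = m + U_(i))%MM.
Proof.
move=> mj; apply/mnmP => k; rewrite !(mnmDE, mnmBE, mnm1E).
by case: (j =P k) => [<-|]; lia.
Qed.

Lemma tail_move (i j : 'I_d) m k : (0 < m j)%N ->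
  (tail (move i j m) k + (k <= j) = tail m k + (k <= i))%N.
Proof.
by move=> mj; have := congr1 (fun m => tail m k) (move_add i mj); rewrite !tailD !tailU.
Qed.

Lemma mdeg_move (i j : 'I_d) m : (0 < m j)%N -> mdeg (move i j m) = mdeg m.
Proof. by move=> mj; have := tail_move i 0 mj; rewrite !tail0; lia. Qed.

(* The last index where the two tails differ carries a positive exponent of [w];
   moving it one step down brings [w] closer to [m]. *)
Lemma move_closed_tails H w m : move_closed H -> w \in H -> mdeg m = mdeg w ->
  (forall k, tail m k <= tail w k)%N -> m \in H.
Proof.
move=> Hmv; have [n] := ubnP (\sum_(k < d) (tail w k - tail m k))%N.
elim: n w => // n IH w /ltnSE le_n wH deg_w lt_w.
have [/existsP[k0 hk0]|/existsPn eqt] := boolP [exists k : 'I_d, (tail m k < tail w k)%N];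
  last first.
  suff -> : m = w by [].
  apply: tail_inj => k; have [kd|dk] := ltnP k d; last by rewrite !tail_out.
  by have := eqt (Ordinal kd); have := lt_w k => /=; lia.
case: (@arg_maxnP _ k0 (fun k : 'I_d => (tail m k < tail w k)%N) (@nat_of_ord d) hk0).
move=> k hk kmax.
have k_gt0 : (0 < k)%N by have := hk; case: (nat_of_ord k) => // ; rewrite !tail0; lia.
have tk1 : tail w k.+1 = tail m k.+1.
  have [kd|dk] := ltnP k.+1 d; last by rewrite !tail_out.
  by have := lt_w k.+1; have := kmax (Ordinal kd) => /=; lia.
have wk : (0 < w k)%N by have := tailS w k; have := tailS m k; lia.
have k1d : (k.-1 < d)%N by have := ltn_ord k; lia.
pose w' := move (Ordinal k1d) k w.
have tw' l : (tail w' l + (l == k :> nat) = tail w l)%N.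
  by have := tail_move (Ordinal k1d) l wk; rewrite -/w' /=; lia.
apply: (IH w').
- apply: leq_trans le_n; rewrite (bigD1 k) //= [X in (_ < X)%N](bigD1 k) //=.
  rewrite -addSn leq_add //; first by have := tw' k; lia.
  by apply: leq_sum => l _; have := tw' l; lia.
- by apply: Hmv => //=; lia.
- by rewrite mdeg_move.
- by move=> l; have := tw' l; have := lt_w l; case: eqP => [->|]; lia.
Qed.

End Moves.

(** * Monomial ideals *)

Section MonomialIdeals.
Variables (K : fieldType) (d : nat).
Implicit Types (G : {fset 'X_{1..d}}) (f : {mpoly K[d]}).

Lemma monomial_idealP G f : generated_ideal (monomials_of G) f <->
  forall m, m \in msupp f -> exists2 g, g \in G & (g <= m)%MM.
Proof.
split=> [[n [c [g [gG ->]]]] m|fG].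
  move=> /msupp_sum_le /flattenP[_ /mapP[i _ ->]].
  have [mi miG ->] := gG i; rewrite (perm_mem (msuppMX _ _)) => /mapP[m' _ ->].
  by exists mi; rewrite ?lem_addr.
pose s := msupp f; pose m (i : 'I_(size s)) := nth 0%MM s i.
have /fin_all_exists2[g gG gm] (i : 'I_(size s)) : exists2 g, g \in G & (g <= m i)%MM.
  by apply: fG; rewrite mem_nth.
exists (size s), (fun i => f@_(m i) *: 'X_[m i - g i]), (fun i => 'X_[g i]).
split=> [i|]; first by exists (g i).
rewrite [LHS]mpolyE (big_nth 0%MM) big_mkord; apply: eq_bigr => i _.
by rewrite -scalerAl -mpolyXD submK // gm.
Qed.

Lemma generated_ideal_sub (S : comAlgType K) (X Y : S -> Prop) :
  (forall g, X g -> exists c h, Y h /\ g = c * h) ->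
  forall x, generated_ideal X x -> generated_ideal Y x.
Proof.
move=> XY x [n [c [g [gX ->]]]].
have /fin_all_exists[a /fin_all_exists[h /all_and2[hY ga]]] i := XY _ (gX i).
exists n, (fun i => c i * a i), h; split=> //.
by apply: eq_bigr => i _; rewrite ga mulrA.
Qed.

End MonomialIdeals.

(** * Upper triangular substitutions *)

Section UpperTriangular.
Variables (K : fieldType) (d : nat).
Implicit Types (M N : 'M[K]_d) (f : {mpoly K[d]}).

Lemma upper_triangular_det M : upper_triangular M -> \det M = \prod_i M i i.
Proof.
move=> Mup; rewrite -det_tr det_trig; last first.
  by apply/is_trig_mxP => i j ij; rewrite mxE Mup.
by apply: eq_bigr => i _; rewrite mxE.
Qed.

(** Expand entry [(i, j)] of [invmx M *m M] for [j < i]: the terms with [k < j] vanish by induction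
    on [j], those with [k > j] since [M] is triangular, and only the multiple of the nonzero [M j j]
    remains. *)
Lemma upper_triangular_inv M :
  M \in unitmx -> upper_triangular M -> upper_triangular (invmx M).
Proof.
move=> Mu Mup i j; have [n] := ubnP (j : nat).
elim: n j => // n IH j /ltnSE jn ji; apply/eqP.
have Mjj : M j j != 0.
  have := Mu; rewrite unitmxE upper_triangular_det // unitfE => /prodf_neq0/(_ j); exact.
suff: (invmx M *m M) i j = invmx M i j * M j j.
  rewrite mulVmx // mxE (_ : (i == j) = false); last by apply/eqP => e; rewrite e ltnn in ji.
  by move/esym/eqP; rewrite mulf_eq0 (negPf Mjj) orbF.
rewrite mxE (bigD1 j) //= big1 ?addr0 // => k kj.
have [jk|jk] := ltnP j k; first by rewrite Mup ?mulr0.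
have {kj}kj : (k < j)%N by rewrite ltn_neqAle jk andbT.
by rewrite IH ?mul0r //; lia.
Qed.

Lemma linear_substX M m :
  linear_subst M 'X_[m] = \prod_(j < d) (\sum_(i < d) M i j *: 'X_i) ^+ m j.
Proof. by rewrite /linear_subst comp_mpolyX; apply: eq_bigr => j _; rewrite tnth_mktuple. Qed.

Lemma linear_subst_mul M N f : linear_subst M (linear_subst N f) = linear_subst (M *m N) f.
Proof.
rewrite /linear_subst [LHS]/= [in LHS](comp_mpolyEX f) raddf_sum [RHS]comp_mpolyEX.
apply: eq_bigr => m _; rewrite /= comp_mpolyZ; congr (_ *: _); rewrite !comp_mpolyX rmorph_prod;
  apply: eq_bigr => j _.
rewrite rmorphXn /= !tnth_mktuple raddf_sum; congr (_ ^+ _) => /=.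
under eq_bigr => i _ do rewrite comp_mpolyZ comp_mpolyXU -tnth_nth tnth_mktuple scaler_sumr.
rewrite exchange_big; apply: eq_bigr => k _ /=; rewrite mxE scaler_suml.
by apply: eq_bigr => i _; rewrite scalerA mulrC.
Qed.

Lemma linear_subst1 f : linear_subst 1%:M f = f.
Proof.
rewrite -[RHS]comp_mpoly_id /linear_subst; congr comp_mpoly; apply: eq_from_tnth => j.
rewrite !tnth_mktuple (bigD1 j) //= mxE eqxx scale1r big1 ?addr0 // => i ij.
by rewrite mxE (negPf ij) scale0r.
Qed.

Definition tail_bounded (m : 'X_{1..d}) f : Prop := forall m', m' \in msupp f ->
  mdeg m' = mdeg m /\ (forall k, tail m' k <= tail m k)%N.

Lemma tail_boundedM m1 m2 f1 f2 :
  tail_bounded m1 f1 -> tail_bounded m2 f2 -> tail_bounded (m1 + m2) (f1 * f2).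
Proof.
move=> h1 h2 m' /msuppM_le /allpairsP[[a b] /= [/h1[da ta] /h2[db tb] ->]].
by split=> [|k]; rewrite ?mdegD ?da ?db // !tailD leq_add.
Qed.

Lemma tail_bounded_linear_subst M m :
  upper_triangular M -> tail_bounded m (linear_subst M 'X_[m]).
Proof.
move=> Mup; rewrite linear_substX {1}[m]multinomUE_id.
have b1 : tail_bounded 0%MM 1.
  by move=> m'; rewrite msupp1 inE => /eqP ->.
apply: (big_ind2 tail_bounded) => //; first by move=> *; apply: tail_boundedM.
move=> j _; elim: (m j) => [|n IH]; first by rewrite mulm0n expr0.
rewrite mulmS exprS; apply: tail_boundedM => // m' /msupp_sum_le /flattenP[_ /mapP[i _ ->]].
have [ji|ij] := ltnP j i; first by rewrite Mup // scale0r msupp0.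
move=> /msuppZ_le; rewrite msuppX inE => /eqP ->.
by split=> [|k]; rewrite ?mdeg1 // !tailU; lia.
Qed.

End UpperTriangular.

(** * Principal Borel sets as tail sets *)

Section BorelSets.
Variables (K : fieldType) (d : nat).
Implicit Types (G H : {fset 'X_{1..d}}).

(** The bound [W] is arbitrary: it need not come from a monomial, and [H] may be empty. *)
Definition tail_set (N : nat) (W : nat -> nat) H : Prop :=
  forall m, m \in H <-> mdeg m = N /\ (forall k, tail m k <= W k)%N.

Lemma tail_set_exists N W : exists H, tail_set N W H.
Proof.
pose P (b : 'X_{1..d < N.+1}) := (mdeg b == N) && [forall k : 'I_d, (tail b k <= W k)%N].
exists [fset bmnm b | b : 'X_{1..d < N.+1} in [pred b | P b]]%fset => m; split.
  case/imfsetP => b /andP[/eqP deg_b /forallP tb] ->; split=> // k.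
  by have [kd|dk] := ltnP k d; [exact: tb (Ordinal kd) | rewrite tail_out].
move=> [deg_m tm]; have lt_m : (mdeg m < N.+1)%N by rewrite deg_m.
apply/imfsetP; exists (BMultinom lt_m) => //.
by apply/andP; split; [rewrite /= deg_m | apply/forallP].
Qed.

(** Substitution does not raise tails, so it maps the ideal into itself; the inverse matrix, again
    upper triangular, gives surjectivity. *)
Lemma tail_set_borel N W H : tail_set N W H -> borel_set K H.
Proof.
move=> HP; split=> [m m' /HP[-> _] /HP[-> _]//|].
have subst_ideal (M : 'M[K]_d) f : upper_triangular M ->
    generated_ideal (monomials_of H) f -> generated_ideal (monomials_of H) (linear_subst M f).
  move=> Mup [n [c [g [gH ->]]]]; rewrite /linear_subst raddf_sum /=.
  apply/monomial_idealP => m /msupp_sum_le /flattenP[_ /mapP[i _ ->]].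
  rewrite rmorphM => /msuppM_le /allpairsP[[a b] /= [_ bs ->]].
  have [h hH gh] := gH i; rewrite gh in bs.
  have [db tb] := tail_bounded_linear_subst Mup bs.
  exists b; last exact: lem_addl.
  apply/HP; have [dh th] := (HP h).1 hH.
  by split=> [|k]; [rewrite db | apply: leq_trans (tb k) (th k)].
move=> M Mu Mup f; split=> [fI|[g gI ->]]; last exact: subst_ideal.
exists (linear_subst (invmx M) f); first by apply: subst_ideal => //; apply: upper_triangular_inv.
by rewrite linear_subst_mul mulmxV // linear_subst1.
Qed.

Hypothesis charK : [pchar K] =i pred0.

Lemma natr_neq0 n : (n.+1%:R : K) != 0.
Proof. by rewrite (pcharf0P _).1. Qed.

(* The substitution x_j := x_j + x_i produces the monomial (x_i / x_j) m with
   coefficient the exponent of x_j in m, which does not vanish in K. *)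
Lemma borel_set_move_closed G : borel_set K G -> move_closed G.
Proof.
move=> [Gdeg GB] m i j mG ij mj.
pose M : 'M[K]_d := 1%:M + delta_mx i j.
have ji : (j == i) = false by apply/eqP => e; rewrite e ltnn in ij.
have Mup : upper_triangular M.
  move=> k l lk; rewrite !mxE (_ : (k == l) = false) ?add0r; last by apply/eqP => e;
    rewrite e ltnn in lk.
  case: eqP => // ki; case: eqP => // lj; subst; lia.
have Mu : M \in unitmx.
  rewrite unitmxE upper_triangular_det // big1 ?unitr1 // => k _; rewrite !mxE eqxx.
  by case: eqP => [->|] /=; rewrite ?addr0 // eq_sym ji addr0.
have substE : linear_subst M 'X_[m] = ('X_j + 'X_i) ^+ m j * 'X_[m - U_(j) *+ m j].
  rewrite linear_substX (bigD1 j) //=; congr (_ * _).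
    congr (_ ^+ _); rewrite (bigD1 j) //= (bigD1 i) ?(eq_sym i) ?ji //= big1 ?addr0; last first.
      by move=> k /andP[kj ki]; rewrite !mxE (negPf kj) (negPf ki) addr0 scale0r.
    by rewrite !mxE !eqxx ji (eq_sym i) ji addr0 add0r !scale1r.
  rewrite mpolyXE_id [RHS](bigD1 j) //= mnmBE mulmnE mnm1E eqxx mul1n subnn expr0 mul1r.
  apply: eq_bigr => k kj; rewrite mnmBE mulmnE mnm1E (eq_sym j) (negPf kj) mul0n subn0.
  congr (_ ^+ _); rewrite (bigD1 k) //= big1 ?addr0; last first.
    by move=> l lk; rewrite !mxE (negPf lk) (negPf kj) andbF addr0 scale0r.
  by rewrite !mxE eqxx (negPf kj) andbF addr0 scale1r.
have coefE : (linear_subst M 'X_[m])@_(move i j m) = (m j)%:R.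
  have -> : move i j m = (m - U_(j) *+ m j + (U_(j) *+ (m j).-1 + U_(i)))%MM.
    apply/mnmP => k; rewrite !(mnmDE, mnmBE, mulmnE, mnm1E).
    by case: (j =P k) => [<-|]; lia.
  rewrite substE mcoeffMX exprDn raddf_sum /=.
  (* Only the binomial term linear in [x_i] has the right exponent of [x_i]. *)
  have lt1 : (1 < (m j).+1)%N by [].
  rewrite (bigD1 (Ordinal lt1)) //= big1 ?addr0 => [|k k1].
    by rewrite mcoeffMn expr1 bin1 mpolyXn subn1 -mpolyXD mcoeffX eqxx.
  rewrite mcoeffMn !mpolyXn -mpolyXD mcoeffX; case: eqP => [/mnmP/(_ i)|]; last by rewrite mul0rn.
  rewrite !(mnmDE, mulmnE, mnm1E) ji eqxx !mul0n !add0n mul1n => e.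
  by case/eqP: k1; apply: val_inj.
have /monomial_idealP/(_ (move i j m)) :
    generated_ideal (monomials_of G) (linear_subst M 'X_[m]).
  apply/(GB M Mu Mup); exists 'X_[m] => //; apply/monomial_idealP => m'.
  by rewrite msuppX inE => /eqP ->; exists m => //; apply: lepm_refl.
rewrite mcoeff_msupp coefE -(prednK mj) natr_neq0 => /(_ isT)[g gG /submK gm].
(* The generator [g] divides the moved monomial and has the same degree. *)
suff <- : g = move i j m by [].
have: mdeg (move i j m - g)%MM = 0%N.
  by have := congr1 (@mdeg d) gm; rewrite mdegD mdeg_move // (Gdeg _ _ gG mG); lia.
by move/eqP; rewrite mdeg_eq0 => /eqP e; rewrite -gm e add0m.
Qed.

(** Minimality of [G] places it inside the tail set of [u], which is Borel; closure under moves
    gives the other inclusion. *)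
Lemma principal_borel_setP G : principal_borel_set K G ->
  exists u : 'X_{1..d}, tail_set (mdeg u) (tail u) G.
Proof.
move=> [u [GB uG Gmin]]; exists u => m; split; last first.
  by move=> [deg_m tm]; apply: move_closed_tails uG _ _ => //; apply: borel_set_move_closed.
have [H HP] := tail_set_exists (mdeg u) (tail u).
have /fsubsetP GH : (G `<=` H)%fset by apply: Gmin; [exact: tail_set_borel HP | exact/HP].
by move/GH/HP.
Qed.

End BorelSets.

(** * Determinants *)

Section Determinants.

Lemma det_neq0_perm (R : comNzRingType) n (A : 'M[R]_n) :
  \det A != 0 -> exists s : 'S_n, forall i, A i (s i) != 0.
Proof.
move=> A0; have [/existsP[s /forallP ?]|/existsPn A_0] :=
  boolP [exists s : 'S_n, [forall i, A i (s i) != 0]]; first by exists s.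
case/eqP: A0; apply: big1 => s _; have [i] := forallPn (A_0 s).
by rewrite negbK => /eqP Ai; rewrite (bigD1 i) //= Ai mul0r mulr0.
Qed.

Lemma det_neq0_kernel (R : idomainType) n (A : 'M[R]_n) :
  (forall c : 'I_n -> R, (forall i, \sum_j A i j * c j = 0) -> forall j, c j = 0) ->
  \det A != 0.
Proof.
move=> ker; rewrite -det_tr; apply/negP => /det0P[c c0 cA].
case/eqP: c0; apply/rowP => j; rewrite mxE; apply: (ker (c 0)) => i.
have /matrixP/(_ 0 i) := cA; rewrite !mxE => cAi; rewrite -[RHS]cAi.
by apply: eq_bigr => k _; rewrite mxE mulrC.
Qed.

(** The cofactors along row [s] do not involve that row, so those of [A] serve for [B]. *)
Lemma det_replace_row (R : comNzRingType) n (A B : 'M[R]_n) s :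
  (forall t, t != s -> row t B = row t A) -> \det B = \sum_k B s k * cofactor A s k.
Proof.
move=> BA; rewrite (expand_det_row _ s); apply: eq_bigr => k _; congr (_ * (_ * \det _)).
apply/matrixP => i j; rewrite !mxE; have ts : lift s i != s by rewrite eq_sym neq_lift.
by have /rowP/(_ (lift k j)) := BA _ ts; rewrite !mxE.
Qed.

End Determinants.

(** * Monomial generators of the Gauss algebra *)

Section GaussMonomials.
Variable d : nat.
Implicit Types (G : {fset 'X_{1..d}}) (v w : 'I_d -> 'X_{1..d}) (u m : 'X_{1..d}).

Definition exps v : 'M[int]_d := \matrix_(i, j) (v i j)%:Z.

Definition mones : 'X_{1..d} := [multinom 1%N | j < d].

Lemma exps_col_gt0 v (j : 'I_d) : \det (exps v) != 0 -> exists i, (0 < v i j)%N.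
Proof.
move=> v0; have [/existsP//|/existsPn vj] := boolP [exists i, (0 < v i j)%N].
case/eqP: v0; rewrite (expand_det_col _ j) big1 // => i _.
by rewrite mxE; have := vj i; rewrite lt0n negbK => /eqP ->; rewrite mul0r.
Qed.

Lemma mones_le_sum v : \det (exps v) != 0 -> (mones <= \sum_i v i)%MM.
Proof.
move=> v0; apply/mnm_lepP => j; have [i vij] := exps_col_gt0 j v0.
by rewrite mnmE mnm_sumE (bigD1 i) //= (leq_trans vij) ?leq_addr.
Qed.

Lemma enum_mon_in G (i : 'I_#|` G|) : enum_mon i \in G.
Proof. exact: mem_nth. Qed.

Lemma enum_mon_inj G : injective (@enum_mon d G).
Proof.
move=> i j /eqP; rewrite nth_uniq ?fset_uniq // => /eqP; exact: val_inj.
Qed.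

Lemma enum_monP G m : m \in G -> exists i : 'I_#|` G|, enum_mon i = m.
Proof.
move=> mG; have lt_m : (index m (enum_fset G) < #|` G|)%N by rewrite index_mem.
by exists (Ordinal lt_m); rewrite /enum_mon /= nth_index.
Qed.

Lemma gauss_monomialE G (s : {ffun 'I_d -> 'I_#|` G|}) :
  gauss_monomial s = (\sum_i enum_mon (s i) - mones)%MM.
Proof. by apply/mnmP => j; rewrite [LHS]mnmE mnmBE mnm_sumE [mones j]mnmE. Qed.

(** Additive form of membership, free of truncated subtraction and of the enumeration of [G]. *)
Lemma gauss_monomialsP G m : m \in gauss_monomials G <-> exists v,
  [/\ forall i, v i \in G, \det (exps v) != 0 & (m + mones = \sum_i v i)%MM].
Proof.
split=> [/imfsetP[s s0 ->]|[v [vG v0 mE]]].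
  exists (fun i => enum_mon (s i)).
  by split=> [i||]; rewrite ?enum_mon_in // gauss_monomialE submK // mones_le_sum.
have /fin_all_exists[s sv] i := enum_monP (vG i).
have svE : (fun i => enum_mon ([ffun i => s i] i)) =1 v by move=> i; rewrite ffunE sv.
apply/imfsetP; exists [ffun i => s i] => /=.
  suff e : exponent_matrix [ffun i => s i] = exps v by rewrite -topredE /= e.
  by apply/matrixP => i j; rewrite !mxE -svE.
by rewrite gauss_monomialE (eq_bigr v) -?mE ?addmK // => i _; apply: svE.
Qed.

Lemma tail_set_move_closed N W G : tail_set N W G -> move_closed G.
Proof.
move=> GP m i j /GP[dm tm] ij mj; apply/GP; rewrite mdeg_move //; split=> // k.
by have := tail_move i k mj; have := tm k; lia.
Qed.

(* If every replacement of some [v s] by [move i j (v s)] destroyed independence,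
   Cramer's rule for [e_i - e_j] would give [- \det (exps v) = - p_j * \det (exps v)],
   where [p_j] is the exponent of [x_j] in the product, contradicting [p_j >= 2]. *)
Lemma gauss_monomials_move_closed G : move_closed G -> move_closed (gauss_monomials G).
Proof.
move=> Gmv m i j /gauss_monomialsP[v [vG v0 mE]] ij mj.
pose C := cofactor (exps v).
have [s vsj Cs] : exists2 s, (0 < v s j)%N & C s i - C s j != - \det (exps v).
  have [/existsP[s /andP[]]|/existsPn allC] := boolP [exists s, (0 < v s j)%N &&
    (C s i - C s j != - \det (exps v))]; first by exists s.
  have adjE k : \sum_s C s k * (v s j)%:Z = (\det (exps v)) *+ (k == j).
    have /matrixP/(_ k j) := mul_adj_mx (exps v); rewrite !mxE => <-.
    by apply: eq_bigr => s _; rewrite !mxE.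
  have : \sum_s (C s i - C s j) * (v s j)%:Z = \sum_s - \det (exps v) * (v s j)%:Z.
    apply: eq_bigr => s _; have := allC s; rewrite negb_and negbK lt0n negbK.
    by case/orP=> /eqP ->; rewrite ?mulr0.
  under eq_bigr => s _ do rewrite mulrBl.
  rewrite sumrB !adjE eqxx (_ : (i == j) = false); last by apply/eqP => e; rewrite e ltnn in ij.
  rewrite -mulr_sumr sub0r mulNr => /oppr_inj /eqP; rewrite mulr1n -subr_eq0 -{1}[\det _]mulr1.
  rewrite -mulrBr mulf_eq0 (negPf v0) /= => /eqP.
  (* The exponent of [x_j] in the product is [m j + 1], and [m j] is positive. *)
  have := congr1 (fun m : 'X_{1..d} => m j) mE; rewrite mnmDE mnmE mnm_sumE.
  rewrite -(big_morph Posz PoszD (erefl 0)) => p1 /eqP.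
  by rewrite subr_eq0 -[1]/(1%N%:Z) eqz_nat => /eqP p_1; move: p1; rewrite -p_1; lia.
pose v' t := if t == s then move i j (v s) else v t.
have v's : v' s = move i j (v s) by rewrite /v' eqxx.
have v't t : t != s -> v' t = v t by rewrite /v' => /negPf ->.
apply/gauss_monomialsP; exists v'; split.
- by move=> t; rewrite /v'; case: eqP => // _; apply: Gmv.
- rewrite (@det_replace_row _ _ (exps v) _ s) => [|t ts]; last first.
    by apply/rowP => k; rewrite !mxE v't.
  have -> : \sum_k exps v' s k * C s k = \det (exps v) + (C s i - C s j).
    rewrite (expand_det_row _ s) -/C.
    have v'E k : exps v' s k + (j == k)%:Z = exps v s k + (i == k)%:Z.
      have := congr1 (fun m : 'X_{1..d} => m k) (move_add i vsj).
      by rewrite mnmDE [RHS]mnmDE !mnm1E !mxE v's -!PoszD => ->.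
    have sumC l : \sum_k (l == k)%:Z * C s k = C s l.
      rewrite (bigD1 l) //= eqxx mul1r big1 ?addr0 // => k kl.
      by rewrite eq_sym (negPf kl) mul0r.
    rewrite -(sumC i) -(sumC j) -sumrB -big_split /=; apply: eq_bigr => k _.
    rewrite -mulrBl -mulrDl; congr (_ * _).
    by apply: (addIr (j == k)%:Z); rewrite v'E -addrA subrK.
  by move: Cs; apply: contra_neq => e; apply/eqP; rewrite -subr_eq0 opprK addrC e.
apply: (@addIm _ U_(j)%MM); rewrite (bigD1 s) //= v's.
rewrite -addmA [(mones + _)%MM]addmC addmA move_add // -addmA [(U_(i) + _)%MM]addmC addmA mE.
rewrite (bigD1 s) //= -!addmA [(_ + U_(j))%MM]addmC [(_ + U_(i))%MM]addmC !addmA move_add //.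
by congr (_ + _)%MM; apply: eq_bigr => t ts; rewrite v't.
Qed.

Lemma tail_constant u k l : (k <= l)%N ->
  (forall i : 'I_d, (k <= i < l)%N -> u i = 0%N) -> tail u k = tail u l.
Proof.
move=> kl u0; rewrite /tail (bigID (fun i : 'I_d => (l <= i)%N)) /= addnC big1 => [|i].
  by apply: eq_bigl => i; apply: andb_idl; apply: leq_trans.
by rewrite -ltnNge; apply: u0.
Qed.

Lemma sum_tail v m k : (m + mones = \sum_i v i)%MM ->
  (tail m k + tail mones k = \sum_i tail (v i) k)%N.
Proof. by move=> mE; rewrite -tailD mE tail_sum. Qed.

Section Extremal.
Variables (G : {fset 'X_{1..d}}) (u : 'X_{1..d}).
Hypothesis GP : tail_set (mdeg u) (tail u) G.

Let u_G : u \in G. Proof. exact/GP. Qed.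

(* Column [0] of [exps v *m Q] holds the degrees, column [k > 0] holds the numbers
   [mdeg u * (tail u k - tail (v i) k)]. *)
Lemma gauss_family_perm v : (0 < mdeg u)%N -> (forall i, v i \in G) -> \det (exps v) != 0 ->
  exists s : 'S_d, forall k : 'I_d, (0 < k)%N -> (tail (v (s k)) k < tail u k)%N.
Proof.
move=> n_gt0 vG v0.
pose Q : 'M[int]_d := \matrix_(i, k)
  if val k == 0 then 1 else (tail u k)%:Z - (mdeg u * (k <= i)%N)%:Z.
have Q0 : \det Q != 0.
  apply: det_neq0_kernel => c Qc.
  (* Rows [i] and [i - 1] of [Q] differ only in column [i], by [- mdeg u]. *)
  have c_gt0 (i : 'I_d) : (0 < i)%N -> c i = 0.
    move=> i_gt0; have i1 : (i.-1 < d)%N by have := ltn_ord i; lia.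
    have : \sum_j (Q i j - Q (Ordinal i1) j) * c j = 0.
      by under eq_bigr => j _ do rewrite mulrBl; rewrite sumrB !Qc subrr.
    rewrite (bigD1 i) //= big1 ?addr0 => [|j ji]; rewrite !mxE /=.
      rewrite gtn_eqF // => /eqP; rewrite mulf_eq0 => /orP[/eqP|/eqP//].
      rewrite leqnn (_ : (i <= i.-1)%N = false); lia.
    case: eqP => [j0|j0]; first by rewrite subrr mul0r.
    have -> : (j <= i.-1)%N = (j <= i)%N.
      by move: ji; rewrite -val_eqE /=; lia.
    by rewrite subrr mul0r.
  move=> i; have [i0|] := posnP i; last exact: c_gt0.
  have := Qc i; rewrite (bigD1 i) //= big1 ?addr0 => [|j ji].
    by rewrite mxE /= i0 mul1r.
  rewrite c_gt0 ?mulr0 // lt0n; apply: contra ji => /eqP j0.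
  by apply/eqP/val_inj; rewrite /= i0 j0.
have VQ0 : \det (exps v *m Q) != 0 by rewrite det_mulmx mulf_neq0.
have [s VQs] := det_neq0_perm VQ0; exists (s^-1)%g => k k_gt0.
have [dv tv] := (GP _).1 (vG ((s^-1)%g k)).
have := VQs ((s^-1)%g k); rewrite permKV; apply: contraR; rewrite -leqNgt => tk.
have {tv tk}tk : tail (v ((s^-1)%g k)) k = tail u k by apply/eqP; rewrite eqn_leq tv.
rewrite mxE; under eq_bigr => i _.
  rewrite !mxE gtn_eqF // mulrBr; over.
rewrite sumrB -mulr_suml -(big_morph Posz PoszD (erefl 0)) -mdegE dv subr_eq0 -PoszM.
apply/eqP.
suff : (\sum_i v ((s^-1)%g k) i * (mdeg u * (k <= i)) = mdeg u * tail u k)%N.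
  by move=> <-; rewrite (big_morph Posz PoszD (erefl 0)); apply: eq_bigr => i _; rewrite PoszM.
rewrite -tk /tail big_distrr /= [RHS]big_mkcond; apply: eq_bigr => i _.
by case: leqP; lia.
Qed.

(** Equivalent to divisibility of [u] by the last variable; vacuous for [d = 0]. *)
Hypothesis uP : forall i : 'I_d, exists l : 'I_d, (i <= l)%N && (0 < u l)%N.

Let next_spec (i : 'I_d) : exists l : 'I_d, [/\ (i <= l)%N, (0 < u l)%N &
  forall j : 'I_d, (i <= j < l)%N -> u j = 0%N].
Proof.
have [l0 hl0] := uP i.
case: (@arg_minnP _ l0 (fun l : 'I_d => (i <= l)%N && (0 < u l)%N) (@nat_of_ord d) hl0).
move=> l /andP[il ul] lmin; exists l; split=> // j /andP[ij jl].
by have := lmin j; rewrite ij /=; lia.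
Qed.

(** Let [l i] be the first index from [i] on whose variable divides [u]. Moving one [x_(l i)] of [u]
    to [x_(i - 1)] gives the largest element of [G] whose tail at [i > 0] is below that of [u];
    together with [u] itself these form [w]. *)
Lemma extremal_family : exists w, [/\ forall i, w i \in G, \det (exps w) != 0 &
  forall v, (forall i, v i \in G) -> \det (exps v) != 0 ->
    exists s : 'S_d, forall i k, (tail (v (s i)) k <= tail (w i) k)%N].
Proof.
have /fin_all_exists[l lP] := next_spec.
have p_lt (i : 'I_d) : (i.-1 < d)%N by have := ltn_ord i; lia.
pose p i := Ordinal (p_lt i).
pose w (i : 'I_d) := if i == 0%N :> nat then u else move (p i) (l i) u.
have wG (i : 'I_d) : w i \in G.
  rewrite /w; case: posnP => // i_gt0; have [il ul _] := lP i.
  by apply: (tail_set_move_closed GP) => //=; lia.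
exists w; split=> //.
  apply: det_neq0_kernel => c wc j.
  have d_gt0 : (0 < d)%N by have := ltn_ord j; lia.
  have lt_top : (d.-1 < d)%N by lia.
  pose o := Ordinal d_gt0; pose top := Ordinal lt_top.
  pose L m := \sum_j (m j)%:Z * c j.
  have LD m m' : L (m + m')%MM = L m + L m'.
    by rewrite -big_split; apply: eq_bigr => k _; rewrite mnmDE PoszD mulrDl.
  have LU k : L U_(k)%MM = c k.
    rewrite /L (bigD1 k) //= mnm1E eqxx mul1r big1 ?addr0 // => k' kk'.
    by rewrite mnm1E eq_sym (negPf kk') mul0r.
  have Lw i : L (w i) = 0 by rewrite -[RHS](wc i); apply: eq_bigr => k _; rewrite mxE.
  have Lu : L u = 0 by have := Lw o.
  (* [L] kills [u] and [w i], so it agrees on the two exchanged variables. Hence [c] is constant,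
     and [L u = 0] makes it zero. *)
  have c_next (i : 'I_d) : (0 < i)%N -> c (p i) = c (l i).
    move=> i_gt0; have := Lw i; rewrite /w gtn_eqF // => Lm.
    have [_ ul _] := lP i.
    have : L (move (p i) (l i) u) + c (l i) = L u + c (p i) by rewrite -!LU -!LD move_add.
    by rewrite Lm Lu !add0r.
  have c_top i : c i = c top.
    have [n] := ubnP (d - i)%N; elim: n i => // n IH i /ltnSE le_n.
    have [i1|i1] := leqP d i.+1.
      by congr c; apply: val_inj => /=; have := ltn_ord i; lia.
    have -> : i = p (Ordinal i1) by apply: val_inj.
    rewrite c_next //=; have [il _ _] := lP (Ordinal i1).
    by apply: IH; move: il => /=; have := ltn_ord (l (Ordinal i1)); lia.
  have := Lu; rewrite /L; under eq_bigr => k _ do rewrite c_top.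
  rewrite -mulr_suml -(big_morph Posz PoszD (erefl 0)) -mdegE c_top => /eqP.
  rewrite mulf_eq0 => /orP[|/eqP//]; rewrite eqz_nat mdeg_eq0 => /eqP u0.
  by have [_] := lP top; rewrite u0 mnm0E.
move=> v vG v0; have [d0|d_gt0] := posnP d.
  by exists 1%g => i; have := ltn_ord i; rewrite [X in (_ < X)%N]d0.
have n_gt0 : (0 < mdeg u)%N.
  have [_ ul _] := lP (Ordinal d_gt0); rewrite lt0n mdeg_eq0; apply/eqP => u0.
  by rewrite u0 mnm0E in ul.
have [s sP] := gauss_family_perm n_gt0 vG v0; exists s => i k.
have [_ tv] := (GP _).1 (vG (s i)).
rewrite /w; case: posnP => [//|i_gt0]; have [il ul u0] := lP i.
have := tail_move (p i) k ul; have := sP i i_gt0; have := tv k; rewrite /=.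
have [ik|ki] := leqP i k; last by lia.
have [kl|lk] := leqP k (l i); last by lia.
(* Tails of [u] are constant from [i] to [l i], so the strict inequality at [i] carries over to
   [k]. *)
have -> : tail u i = tail u k.
  by apply: tail_constant => // j /andP[ij jk]; apply: u0; rewrite ij (leq_trans jk).
by have := tail_anti (v (s i)) ik; lia.
Qed.

End Extremal.

Lemma gauss_monomials_tail_set G u : tail_set (mdeg u) (tail u) G ->
  exists N W, tail_set N W (gauss_monomials G).
Proof.
move=> GP; have [G0|[m0 m0G]] := fset_0Vmem (gauss_monomials G).
  (* Degree 1 contradicts the bound 0 on the tail at 0, so this tail set is empty. *)
  exists 1%N, (fun=> 0%N) => m; split; first by rewrite G0 in_fset0.
  by move=> [dm /(_ 0%N)]; rewrite tail0 dm.
have [w [wG w0 wmax]] : exists w, [/\ forall i, w i \in G, \det (exps w) != 0 &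
  forall v, (forall i, v i \in G) -> \det (exps v) != 0 ->
    exists s : 'S_d, forall i k, (tail (v (s i)) k <= tail (w i) k)%N].
  apply: (extremal_family GP) => i; have /gauss_monomialsP[v [vG v0 _]] := m0G.
  (* Some [v s] is divisible by the last variable, since that column is nonzero; the tail bound
     passes this on to [u]. *)
  have lt_top : (d.-1 < d)%N by have := ltn_ord i; lia.
  exists (Ordinal lt_top); apply/andP; split; first by have := ltn_ord i => /=; lia.
  have [s vs] := exps_col_gt0 (Ordinal lt_top) v0.
  have [_ /(_ d.-1)] := (GP _).1 (vG s).
  by rewrite !(tailS _ (Ordinal lt_top)) !tail_out /=; lia.
have /submK mwE := mones_le_sum w0; set mw := (_ - mones)%MM in mwE.
have mwG : mw \in gauss_monomials G by apply/gauss_monomialsP; exists w.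
exists (mdeg mw), (tail mw) => m; split; last first.
  move=> [dm tm]; apply: move_closed_tails mwG dm tm.
  by apply: gauss_monomials_move_closed; apply: tail_set_move_closed GP.
move=> /gauss_monomialsP[v [vG v0 mE]]; split.
  apply: (@addIn (tail mones 0)); rewrite -!tail0 (sum_tail 0 mE) (sum_tail 0 mwE).
  by apply: eq_bigr => i _; rewrite !tail0 ((GP _).1 (wG i)).1 ((GP _).1 (vG i)).1.
move=> k; have [s sP] := wmax v vG v0.
rewrite -(leq_add2r (tail mones k)) (sum_tail k mE) (sum_tail k mwE).
by rewrite (reindex_inj (@perm_inj _ s)); apply: leq_sum => i _.
Qed.

End GaussMonomials.

(** * Subalgebras and almost integral fractions *)

Section Subalgebras.
Variables (K : fieldType) (S : comAlgType K) (A : S -> Prop).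
Hypothesis Aalg : subalgebra A.

Lemma subalgD x y : A x -> A y -> A (x + y). Proof. by case: Aalg => _ AD _; apply: AD. Qed.
Lemma subalgM x y : A x -> A y -> A (x * y). Proof. by case: Aalg => _ _; apply. Qed.
Lemma subalgA c : A c%:A. Proof. by case: Aalg. Qed.
Lemma subalg0 : A 0. Proof. by rewrite -(scale0r 1); apply: subalgA. Qed.
Lemma subalg1 : A 1. Proof. by rewrite -(scale1r 1); apply: subalgA. Qed.
Lemma subalgZ c x : A x -> A (c *: x).
Proof. by move=> Ax; rewrite -mulr_algl; apply/subalgM/Ax/subalgA. Qed.
Lemma subalgB x y : A x -> A y -> A (x - y).
Proof. by move=> Ax Ay; apply: subalgD => //; rewrite -scaleN1r; apply: subalgZ. Qed.
Lemma subalgX n x : A x -> A (x ^+ n).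
Proof.
by move=> Ax; elim: n => [|n IH]; rewrite ?expr0 ?exprS; [exact: subalg1 | exact: subalgM].
Qed.
Lemma subalg_sum (I : Type) (r : seq I) (P : pred I) (F : I -> S) :
  (forall i, P i -> A (F i)) -> A (\sum_(i <- r | P i) F i).
Proof. by move=> AF; apply: big_ind => //; [apply: subalg0 | apply: subalgD]. Qed.

End Subalgebras.

Lemma generated_subalgebra_alg (K : fieldType) (S : comAlgType K) (X : S -> Prop) :
  subalgebra (generated_subalgebra X).
Proof.
split=> [c|x y Ax Ay|x y Ax Ay] B Balg BX; first exact: subalgA.
  by apply: subalgD; [|apply: Ax|apply: Ay].
by apply: subalgM; [|apply: Ax|apply: Ay].
Qed.

(* An integral fraction [a / b] is almost integral: the powers of [a / b] lie in
   the span of the first [n], so [b ^+ n] is a common denominator. *)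
Lemma integral_almost_integral (K : fieldType) (d : nat) (A : {mpoly K[d]} -> Prop)
    (a b : {mpoly K[d]}) (p : {poly {mpoly K[d]}}) :
  subalgebra A -> A a -> A b -> b != 0 ->
  p \is monic -> (forall i, A p`_i) ->
  root (map_poly (@tofrac _) p) (tofrac a / tofrac b) ->
  exists n, forall k, exists2 h, A h & b ^+ n * a ^+ k = h * b ^+ k.
Proof.
move=> Aalg Aa Ab b0 pmonic Ap; set z := tofrac a / tofrac b => /eqP pz.
have fb0 : tofrac b != 0 by rewrite tofrac_eq0.
have zb : z * tofrac b = tofrac a by rewrite mulfVK.
clearbody z.
have [n szp] : exists n, size p = n.+2.
  case szp: (size p) => [|[|n]]; last by exists n.
    by have := monic_neq0 pmonic; rewrite -size_poly_eq0 szp.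
  have p1 : p = 1.
    have /size_poly1P[c _ pc] : size p == 1%N by rewrite szp.
    by move: pmonic; rewrite pc monicE lead_coefC => /eqP ->.
  by move/eqP: pz; rewrite p1 rmorph1 hornerC oner_eq0.
have pn : p`_n.+1 = 1 by move/monicP: pmonic; rewrite lead_coefE szp.
exists n.+1 => k.
(* [q] is the remainder of the [k]-th power of the indeterminate modulo the monic [p]. *)
have [q [szq Aq qz]] : exists q : {poly {mpoly K[d]}},
    [/\ (size q <= n.+1)%N, forall i, A q`_i & (map_poly (@tofrac _) q).[z] = z ^+ k].
  elim: k => [|k [q [szq Aq qz]]].
    exists 1; split=> [|i|]; first by rewrite size_poly1.
      by rewrite coef1; case: eqP => _; [apply: subalg1 | apply: subalg0].
    by rewrite rmorph1 hornerC.
  exists (q * 'X - q`_n *: p); split=> [|i|].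
  - apply/leq_sizeP => j; rewrite leq_eqVlt => /predU1P[<-|nj].
      by rewrite coefB coefMX coefZ pn mulr1 subrr.
    rewrite coefB coefMX coefZ (gtn_eqF (leq_trans _ nj)) //.
    rewrite [p`_j]nth_default ?szp // mulr0 nth_default ?subr0 //.
    by case: j nj => // j; rewrite ltnS; apply: leq_trans.
  - rewrite coefB coefMX coefZ; apply: subalgB => //; last exact: subalgM.
    by case: eqP => _; [apply: subalg0 | apply: Aq].
  - rewrite rmorphB rmorphM /= map_polyX map_polyZ hornerD hornerN hornerZ pz mulr0 subr0.
    by rewrite hornerMX qz exprSr.
exists (\sum_(i < n.+1) q`_i * (a ^+ i * b ^+ (n.+1 - i))).
  apply: subalg_sum => // i _; apply: subalgM => //.
  by apply: subalgM => //; apply: subalgX.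
apply/eqP; rewrite -tofrac_eq !tofracM !tofracXn -zb exprMn -qz.
rewrite (horner_coef_wide _ (leq_trans (size_poly _ _) szq)) rmorph_sum /=.
apply/eqP; rewrite mulrA; congr (_ * _); rewrite mulr_sumr; apply: eq_bigr => i _.
rewrite coef_map /= !tofracM !tofracXn -zb exprMn mulrCA; congr (_ * _).
by rewrite -mulrA -exprD subnKC 1?ltnW // mulrC.
Qed.

(** * Cone algebras: generation by a tail set, and normality *)

Section ConeAlgebra.
Variables (K : fieldType) (d N : nat) (W : nat -> nat).
Implicit Types (m : 'X_{1..d}) (f : {mpoly K[d]}).

(** [c] counts factors: a product of [c] elements of the tail set satisfies the bounds, and the
    splitting in [cone_algebra_generated] gives the converse. *)
Definition in_cone m : Prop :=
  exists c : nat, mdeg m = (c * N)%N /\ forall k, (tail m k <= c * W k)%N.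

Definition cone_algebra f : Prop := forall m, m \in msupp f -> in_cone m.

Lemma in_cone0 : in_cone 0%MM.
Proof. by exists 0%N; rewrite mdeg0; split=> // k; rewrite tail0m. Qed.

Lemma in_coneD m m' : in_cone m -> in_cone m' -> in_cone (m + m')%MM.
Proof.
move=> [c [dc tc]] [c' [dc' tc']]; exists (c + c')%N; rewrite mdegD dc dc' mulnDl.
by split=> // k; rewrite tailD mulnDl leq_add.
Qed.

Lemma cone_algebra_alg : subalgebra cone_algebra.
Proof.
split=> [c m|f g fC gC m|f g fC gC m].
- rewrite alg_mpolyC msuppC; case: eqP => // _; rewrite inE => /eqP ->; exact: in_cone0.
- by move=> /msuppD_le; rewrite mem_cat => /orP[/fC|/gC].
- by move=> /msuppM_le /allpairsP[[a b] /= [/fC ? /gC ? ->]]; apply: in_coneD.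
Qed.

Lemma cone_algebraX m : in_cone m -> cone_algebra 'X_[m].
Proof. by move=> mC m'; rewrite msuppX inE => /eqP ->. Qed.

(* A monomial of degree [c.+1 * N] splits off the element of [H] whose tails are the
   quotients of its tails by [c.+1]. *)
Lemma cone_algebra_generated H (B : {mpoly K[d]} -> Prop) : tail_set N W H ->
  subalgebra B -> (forall m, m \in H -> B 'X_[m]) -> forall f, cone_algebra f -> B f.
Proof.
move=> HP Balg BH f fC; rewrite [f]mpolyE big_seq; apply: subalg_sum => // m /fC[c].
move=> mC; apply: subalgZ => //; elim: c m mC => [|c IH] m [dm tm].
  suff -> : m = 0%MM by rewrite mpolyX0; apply: subalg1.
  by apply/eqP; rewrite -mdeg_eq0 dm.
pose t k := (tail m k %/ c.+1)%N; pose g := of_tails d t.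
have tg k : tail g k = t k.
  rewrite tail_of_tails // => j; first by rewrite leq_div2r // tail_anti.
  by move=> dj; rewrite /t tail_out // div0n.
have gH : g \in H.
  apply/HP; split=> [|k]; first by rewrite -tail0 tg /t tail0 dm mulKn.
  by rewrite tg -(mulKn (W k) (ltn0Sn c)) leq_div2r.
have gm : (g <= m)%MM.
  apply/mnm_lepP => j; rewrite mnmE /t leq_subLR tailS.
  by rewrite [leqRHS]addnC -divnMDl // leq_div2r // leq_add2r leq_pmulr.
rewrite -(submK gm) mpolyXD; apply: subalgM; [|apply: IH|exact: BH] => //.
have tmg k : (tail (m - g)%MM k + t k = tail m k)%N by rewrite -tg -tailD submK.
split=> [|k]; first by have := tmg 0%N; rewrite /t !tail0 dm mulKn //; lia.
have := tmg k; have := tm k; rewrite /t; have := divn_eq (tail m k) c.+1.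
have := ltn_pmod (tail m k) (ltn0Sn c); have := leq_div2r c.+1 (tm k); rewrite mulKn //.
(* If [q = W k], the bound on [m] suffices; otherwise [q < W k] and [r <= c]. *)
by move: (_ %/ _)%N (_ %% _)%N => q r; rewrite leq_eqVlt => /predU1P[->|]; nia.
Qed.

(** The inequalities are linear, so any violation by [r - b] grows with [k] and outruns the fixed
    contribution of [l]. *)
Lemma in_cone_saturated l r b : in_cone l -> in_cone r -> in_cone b ->
  (forall k, exists2 h, in_cone h & (l + r *+ k = h + b *+ k)%MM) ->
  (b <= r)%MM /\ in_cone (r - b)%MM.
Proof.
move=> [cl [dl tl]] [cr [dr tr]] [cb [db tb]] sat.
have br : (b <= r)%MM.
  apply/mnm_lepP => j; have [h _ /(congr1 (fun m : 'X_{1..d} => m j))] := sat (l j).+1.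
  by rewrite !mnmDE !mulmnE; nia.
split=> //; have rE := submK br; set m := (r - b)%MM in rE *.
have [N0|N_gt0] := posnP N.
  suff -> : m = 0%MM by apply: in_cone0.
  by apply/eqP; rewrite -mdeg_eq0; have := congr1 (@mdeg d) rE; rewrite mdegD dr N0 muln0; lia.
have dm : mdeg m = ((cr - cb) * N)%N.
  by have := congr1 (@mdeg d) rE; rewrite mdegD mulnBl dr db; lia.
exists (cr - cb)%N; split=> // k; set c := (cr - cb)%N in dm *.
(* An excess of one, taken [cl * W k + 1] times, exceeds the slack [cl * W k] that [l] can
   provide. *)
have [h [ch [dh th]] e] := sat (cl * W k).+1.
have {}e : (l + m *+ (cl * W k).+1 = h)%MM.
  by apply: (@addIm _ (b *+ (cl * W k).+1)%MM); rewrite -e -rE; apply/mnmP => i;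
    rewrite !(mnmDE, mulmnE); nia.
have ch_eq : ch = (cl + c * (cl * W k).+1)%N.
  by have := congr1 (@mdeg d) e; rewrite mdegD mdegMn dl dm dh; nia.
have := th k; rewrite -e tailD tailMn ch_eq; nia.
Qed.

(* Divide by [b] for the degrevlex order: almost integrality forces every leading
   monomial met on the way to be divisible by the one of [b] inside the cone. *)
Lemma cone_algebra_division f b a : f != 0 -> cone_algebra f -> b != 0 -> cone_algebra b ->
  cone_algebra a -> (forall k, exists2 h, cone_algebra h & f * a ^+ k = h * b ^+ k) ->
  exists2 c, cone_algebra c & a = c * b.
Proof.
move=> f0 fC b0 bC; have alg := cone_algebra_alg.
elim/mleadrect: a => a IH aC aP.
have [->|a0] := eqVneq a 0; first by exists 0; [apply: (subalg0 alg) | rewrite mul0r].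
have [ba mC] : (mlead b <= mlead a)%MM /\ in_cone (mlead a - mlead b)%MM.
  apply: in_cone_saturated (fC _ (mlead_supp f0)) (aC _ (mlead_supp a0)) (bC _ (mlead_supp b0)) _.
  move=> k; have [h hC e] := aP k.
  have h0 : h != 0.
    by apply/eqP => h0; move/eqP: e; rewrite h0 mul0r mulf_eq0 (negPf f0) expf_eq0 (negPf a0) andbF.
  exists (mlead h); first by apply: hC; apply: mlead_supp.
  by have := congr1 (@mlead d K) e; rewrite !mleadM ?mleadX ?expf_neq0.
set m := (_ - _)%MM in mC; pose q := (mleadc a / mleadc b) *: 'X_[m].
have qC : cone_algebra q by apply: (subalgZ alg) => //; apply: cone_algebraX.
have [e|a'0] := eqVneq (a - q * b) 0; first by exists q => //; apply/eqP; rewrite -subr_eq0 e.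
have lcb : mleadc b != 0 by rewrite mleadc_eq0.
have qb : (q * b)@_(mlead a) = mleadc a.
  by rewrite -{1}(submK ba) -/m -scalerAl mcoeffZ ['X_[m] * b]mulrC mcoeffMX divfK.
have [||k|c cC e] := IH (a - q * b).
- have le_a : (mlead (a - q * b) <= mlead a)%O.
    apply: le_trans (mleadB_le _ _) _; rewrite leUx lexx /=.
    apply: le_trans (mleadM_le _ _) _; rewrite -[leRHS](submK ba) lemc_add2l.
    by apply: le_trans (mleadZ_le _ _) _; rewrite mleadXm.
  rewrite lt_neqAle le_a andbT; apply: contra_neq (a'0) => e; apply/eqP.
  by rewrite -mleadc_eq0 e mcoeffB qb subrr.
- by apply: (subalgB alg) => //; apply: (subalgM alg).
(* Almost integrality passes to [a - q * b]: expand its power and apply the hypothesis to each power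
   of [a]. *)
- rewrite exprBn mulr_sumr.
  apply: (big_ind (fun x => exists2 h, cone_algebra h & x = h * b ^+ k)).
  + by exists 0; [apply: (subalg0 alg) | rewrite mul0r].
  + move=> _ _ [h hC ->] [h' h'C ->]; exists (h + h'); last by rewrite mulrDl.
    exact: (subalgD alg).
  + move=> i _; have [h hC e] := aP (k - i)%N.
    exists (((-1) ^+ i *+ 'C(k, i)) * (h * q ^+ i)).
      apply: (subalgM alg) => //; last by apply: (subalgM alg) => //; apply: (subalgX alg).
      rewrite -mulr_natr; apply: (subalgM alg) => //.
        apply: (subalgX alg) => //; rewrite -scaleN1r; apply: (subalgZ alg) => //;
          exact: (subalg1 alg).
      by rewrite -scaler_nat; apply: (subalgA alg).
    rewrite -mulrnAl -mulrnAl -!mulrA mulrCA; congr (_ * _).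
    rewrite [LHS]mulrA e exprMn -!mulrA; congr (_ * _); rewrite mulrCA; congr (_ * _).
    by rewrite -exprD subnK // -ltnS.
exists (c + q); last by rewrite mulrDl -e subrK.
exact: (subalgD alg).
Qed.

Lemma cone_algebra_normal (A : {mpoly K[d]} -> Prop) :
  (forall f, A f <-> cone_algebra f) -> normal_subring A.
Proof.
move=> AC a b /AC aC /AC bC b0 [p [pmonic pA pz]].
have pC i : cone_algebra p`_i by apply/AC.
have [n nP] := integral_almost_integral cone_algebra_alg aC bC b0 pmonic pC pz.
have [||c cC ->] := @cone_algebra_division (b ^+ n) b a _ _ b0 bC aC nP.
- exact: expf_neq0.
- exact: (subalgX cone_algebra_alg).
by exists c; [apply/AC | rewrite tofracM mulfK // tofrac_eq0].
Qed.

End ConeAlgebra.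

(** * Jacobian minors and the Gauss algebra as a cone algebra *)

Section Jacobians.
Variables (K : fieldType) (d : nat).
Implicit Types (v : 'I_d -> 'X_{1..d}).

(** Multiplying column [j] by [x_j] turns the derivative of [v i] into [v i j] times [v i], so row
    [i] acquires the factor [v i]. *)
Lemma det_jacobian_monomials v :
  \det (\matrix_(i, j) mderiv j 'X_[K, v i]) * 'X_[mones d] =
  (\det (exps v))%:~R * 'X_[\sum_i v i] :> {mpoly K[d]}.
Proof.
have -> : 'X_[mones d] = \det (diag_mx (\row_j 'X_j)) :> {mpoly K[d]}.
  rewrite det_diag mpolyXE_id; apply: eq_bigr => j _; by rewrite mxE mnmE expr1.
have -> : 'X_[\sum_i v i] = \det (diag_mx (\row_i 'X_[v i])) :> {mpoly K[d]}.
  by rewrite det_diag -mprodXE; apply: eq_bigr => i _; rewrite mxE.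
rewrite -det_mulmx mulrC -det_map_mx -det_mulmx mul_mx_diag mul_diag_mx; congr (\det _).
apply/matrixP => i j; rewrite !mxE mderivX -scalerAl -mpolyXD -[RHS]mulrC.
rewrite /= -pmulrn mulr_natl -scaler_nat.
have [->|vij] := eqVneq (v i j) 0%N; first by rewrite !scale0r.
by rewrite submK // lep1mP.
Qed.

End Jacobians.

(** A minor is zero or an integer multiple of a Gauss monomial, and characteristic zero makes that
    nonzero integer invertible. *)
Lemma gauss_algebraP (K : fieldType) (d N : nat) (W : nat -> nat) (G : {fset 'X_{1..d}}) :
  [pchar K] =i pred0 -> tail_set N W (gauss_monomials G) -> forall f,
  gauss_algebra (fun i : 'I_#|` G| => 'X_[K, enum_mon i]) f <-> cone_algebra N W f.
Proof.
move=> charK GP f; split.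
  apply; first exact: cone_algebra_alg.
  move=> _ [s s_inj ->]; pose v i := enum_mon (s i).
  have := det_jacobian_monomials K v.
  rewrite (_ : rowsub _ _ = \matrix_(i, j) mderiv j 'X_[K, v i]); last first.
    by apply/matrixP => i j; rewrite !mxE.
  have X0 m : 'X_[m] != 0 :> {mpoly K[d]} by rewrite -msupp_eq0 msuppX.
  have [->|v0] := eqVneq (\det (exps v)) 0.
    rewrite mul0r => /eqP; rewrite mulf_eq0 (negPf (X0 _)) orbF => /eqP ->.
    exact: (subalg0 (cone_algebra_alg _ _ _ _)).
  have /submK mE := mones_le_sum v0.
  rewrite -mE mpolyXD mulrA => /(mulIf (X0 _)) ->.
  rewrite mulrzl -scaler_int; apply: (subalgZ (cone_algebra_alg _ _ _ _)).
  apply: cone_algebraX; exists 1%N; rewrite mul1n.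
  have /GP[dm tm] : (\sum_i v i - mones d)%MM \in gauss_monomials G.
    by apply/gauss_monomialsP; exists v; split=> // i; apply: enum_mon_in.
  by split=> // k; rewrite mul1n.
have galg : subalgebra (gauss_algebra (fun i : 'I_#|` G| => 'X_[K, enum_mon i])).
  exact: generated_subalgebra_alg.
apply: (cone_algebra_generated GP galg _ (f := f)) => m /gauss_monomialsP[v [vG v0 mE]].
have /fin_all_exists[s sv] i := enum_monP (vG i).
have s_inj : injective s.
  move=> i j sij; apply/eqP; apply: contraT => ij; case/eqP: v0.
  by apply: (determinant_alternate ij) => k; rewrite !mxE -!sv sij.
have vK0 : (\det (exps v))%:~R != 0 :> K.
  case: (\det (exps v)) v0 => [[|n]|n] // _; first by rewrite -pmulrn natr_neq0.
  by rewrite NegzE mulrNz oppr_eq0 -pmulrn natr_neq0.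
have : gauss_algebra (fun i : 'I_#|` G| => 'X_[K, enum_mon i])
    (\det (rowsub s (jacobian (fun i => 'X_[K, enum_mon i])))).
  by move=> B Balg; apply; exists s.
rewrite (_ : rowsub _ _ = \matrix_(i, j) mderiv j 'X_[K, v i]); last first.
  by apply/matrixP => i j; rewrite !mxE sv.
have X0 : 'X_[mones d] != 0 :> {mpoly K[d]} by rewrite -msupp_eq0 msuppX.
have := det_jacobian_monomials K v; rewrite -mE mpolyXD mulrA => /(mulIf X0) ->.
move=> /(subalgZ galg (\det (exps v))%:~R^-1).
by rewrite mulrzl -scaler_int scalerA mulVf // scale1r.
Qed.

(** * Monomial orders and a criterion for Groebner bases *)

Section Orders.
Variables (K : fieldType) (n : nat).
Implicit Types (le : rel 'X_{1..n}) (w : 'X_{1..n} -> nat) (I : {mpoly K[n]} -> Prop).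

Definition refine w le : rel 'X_{1..n} :=
  fun a b => (w a < w b)%N || ((w a == w b) && le a b).

Lemma refine_monomial_order w le : {morph w : a b / (a + b)%MM >-> (a + b)%N} ->
  monomial_order le -> monomial_order (refine w le).
Proof.
move=> wD [refl anti trans tot ge0 add].
have w0 : w 0%MM = 0%N by have := wD 0%MM 0%MM; rewrite add0m; lia.
split; rewrite /refine.
- by move=> a; rewrite eqxx refl orbT.
- move=> a b /andP[/orP[ab|/andP[/eqP ab leab]] /orP[ba|/andP[/eqP ba leba]]]; try lia.
  by apply: anti; rewrite leab leba.
- move=> b a c /orP[ab|/andP[/eqP -> leab]] /orP[bc|/andP[/eqP <- lebc]].
  + by rewrite (ltn_trans ab bc).
  + by rewrite ab.
  + by rewrite bc.
  + by rewrite eqxx (trans _ _ _ leab lebc) orbT.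
- by move=> a b; case: ltngtP => //= _; apply: tot.
- by move=> m; rewrite w0 ge0 andbT orbC -leq_eqVlt.
- move=> a b m; rewrite !wD ltn_add2r eqn_add2r => /orP[->//|/andP[-> leab]].
  by rewrite add ?orbT.
Qed.

Lemma degrevlex_monomial_order : monomial_order (fun a b : 'X_{1..n} => (a <= b)%O).
Proof.
split=> [a|a b|b a c|a b|m|a b m]; [exact: lexx|exact: le_anti|
  exact: le_trans|exact: le_total|exact: le0m|].
by rewrite lemc_add2l.
Qed.

Lemma groebner_basisP le I (B : seq {mpoly K[n]}) :
  (forall g, g \in B -> I g /\ g != 0) ->
  (forall f m, I f -> leading_monomial le f m ->
     exists2 g, g \in B & exists2 l, leading_monomial le g l & (l <= m)%MM) ->
  groebner_basis le I B.
Proof.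
move=> BI BP; split=> // f; split; apply: generated_ideal_sub => _ [g [m [Ig gm ->]]].
  have [h hB [l hl lm]] := BP _ _ Ig gm.
  exists 'X_[m - l], 'X_[l]; split; first by exists h, l.
  by rewrite -mpolyXD submK.
exists 1, 'X_[m]; rewrite mul1r; split=> //; exists g, m; split=> //.
by have [] := BI _ Ig.
Qed.

Lemma leading_monomial_binomial le (a b : 'X_{1..n}) :
  reflexive le -> a != b -> le b a -> leading_monomial le ('X_[K, a] - 'X_[b]) a.
Proof.
move=> refl ab ba; split=> [|m /msuppB_le].
  by rewrite mcoeff_msupp mcoeffB !mcoeffX eqxx [b == a]eq_sym (negPf ab) subr0 oner_eq0.
by rewrite !msuppX !inE => /orP[/eqP ->|/eqP ->].
Qed.

End Orders.

(** * Toric ideals and their fibers *)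

Section ToricIdeals.
Variables (K : fieldType) (d : nat) (H : {fset 'X_{1..d}}).
Local Notation n := #|` H|.
Implicit Types (mu nu : 'X_{1..n}) (f : {mpoly K[n]}).

Definition toric_image mu : 'X_{1..d} := (\sum_i enum_mon i *+ mu i)%MM.

Lemma toric_imageD mu nu : toric_image (mu + nu) = (toric_image mu + toric_image nu)%MM.
Proof.
by rewrite -big_split; apply: eq_bigr => i _; apply/mnmP => j; rewrite !(mnmDE, mulmnE) mulnDr.
Qed.

Lemma toric_imageU i : toric_image U_(i) = enum_mon i.
Proof.
rewrite /toric_image (bigD1 i) //= mnm1E eqxx mulm1n big1 ?addm0 // => j ji.
by rewrite mnm1E eq_sym (negPf ji) mulm0n.
Qed.

Lemma toric_compX mu :
  'X_[mu] \mPo [tuple 'X_[K, enum_mon i] | i < n] = 'X_[toric_image mu].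
Proof. by rewrite comp_mpolyX -mprodXnE; apply: eq_bigr => i _; rewrite tnth_mktuple. Qed.

Lemma toric_ideal_binomial mu nu :
  toric_image mu = toric_image nu -> @toric_ideal K d H ('X_[mu] - 'X_[nu]).
Proof. by move=> e; rewrite /toric_ideal raddfB /= !toric_compX e subrr. Qed.

(** Were [mu] alone in its fiber, its coefficient would survive in the image of [f]. *)
Lemma toric_ideal_fiber f mu : @toric_ideal K d H f -> mu \in msupp f ->
  exists nu, [/\ nu \in msupp f, nu != mu & toric_image nu = toric_image mu].
Proof.
move=> fI muf; have [/hasP[nu nuf /andP[numu /eqP e]]|/hasPn none] :=
    boolP (has (fun nu => (nu != mu) && (toric_image nu == toric_image mu)) (msupp f)).
  by exists nu.
have := congr1 (mcoeff (toric_image mu)) fI; rewrite comp_mpolyEX raddf_sum mcoeff0.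
rewrite (bigD1_seq mu) ?msupp_uniq //= big_seq_cond big1 => [|nu /andP[nuf numu]].
  rewrite addr0 toric_compX mcoeffZ mcoeffX eqxx mulr1 => /eqP.
  by rewrite mcoeff_eq0 muf.
rewrite toric_compX mcoeffZ mcoeffX; have := none nu nuf; rewrite numu /= => /negPf ->.
by rewrite mulr0.
Qed.

Definition monomial_weight (c : 'I_n -> nat) mu : nat := \sum_i c i * mu i.

Lemma monomial_weightD c :
  {morph monomial_weight c : mu nu / (mu + nu)%MM >-> (mu + nu)%N}.
Proof.
by move=> mu nu; rewrite -big_split; apply: eq_bigr => i _; rewrite mnmDE mulnDr.
Qed.

Lemma monomial_weightU c i : monomial_weight c U_(i) = c i.
Proof.
rewrite /monomial_weight (bigD1 i) //= mnm1E eqxx muln1 big1 ?addn0 // => j ji.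
by rewrite mnm1E eq_sym (negPf ji) muln0.
Qed.

Lemma tail_toric_image mu k :
  tail (toric_image mu) k = monomial_weight (fun i => tail (enum_mon i) k) mu.
Proof. by rewrite tail_sum; apply: eq_bigr => i _; rewrite tailMn. Qed.

End ToricIdeals.

(** * Sorting relations and the quadratic Groebner basis *)

Lemma sum_squares_halves a b (s := ((a + b)./2 ^ 2 + uphalf (a + b) ^ 2)%N) :
  (s <= a ^ 2 + b ^ 2)%N /\
  (~~ ((a <= b.+1) && (b <= a.+1)) -> s < a ^ 2 + b ^ 2)%N.
Proof.
rewrite {}/s; wlog ab : a b / (a <= b)%N.
  by move=> Hw; case/orP: (leq_total a b) => /Hw //; rewrite (addnC b a) (addnC (b ^ 2)%N) andbC.
have := odd_double_half (a + b); rewrite uphalf_half -addnn -!mulnn.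
move: ((a + b)./2) (odd _) => h o e.
(* With [o] the parity of [a + b], the halves are [a + k] and [a + k + o], while
   [b = a + 2k + o]. *)
have [k hk] : exists k, h = (a + k)%N by exists (h - a)%N; case: o e; lia.
have -> : b = (h + k + o)%N by lia.
rewrite hk; case: o {e} => /=; split; nia.
Qed.

Section Sorting.
Variables (K : fieldType) (d N : nat) (W : nat -> nat) (H : {fset 'X_{1..d}}).
Hypothesis HP : tail_set N W H.
Local Notation n := #|` H|.
Implicit Types (i j : 'I_n) (mu nu : 'X_{1..n}).

Let T i k := tail (enum_mon i) k.

Let T_inj i j : (forall k, T i k = T j k) -> i = j.
Proof. by move=> e; apply/enum_mon_inj/tail_inj. Qed.

Let T0 i : T i 0 = N. Proof. by rewrite /T tail0; case: ((HP _).1 (enum_mon_in i)). Qed.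

Let T_le i k : (T i k <= W k)%N.
Proof. by case: ((HP _).1 (enum_mon_in i)) => _; apply. Qed.

Let T_out i k : (d <= k)%N -> T i k = 0%N. Proof. exact: tail_out. Qed.

(** Exactly then the floor and the ceiling of the half sums of tails give back [i] and [j], in this
    order. *)
Definition near_tails i j : bool :=
  [forall k : 'I_d, (T i k <= T j k <= (T i k).+1)%N].

Definition sorted_pair i j : bool := near_tails i j || near_tails j i.

Let near_tailsP i j : reflect (forall k, T i k <= T j k <= (T i k).+1)%N (near_tails i j).
Proof.
apply: (iffP forallP) => [nij k|nij k]; last exact: nij.
by have [kd|dk] := ltnP k d; [exact: nij (Ordinal kd) | rewrite !T_out].
Qed.

(** Equivalently, no product of an unsorted pair of variables divides [mu]. *)
Definition standard mu : Prop :=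
  forall i j, (0 < mu i)%N -> (0 < mu j)%N -> sorted_pair i j.

Lemma sort_pair i j : exists lo hi : 'I_n, forall k,
  T lo k = (T i k + T j k)./2 /\ T hi k = uphalf (T i k + T j k).
Proof.
(* Treats floor and ceiling at once: monotonicity makes the new tails nonincreasing, and
   [h (a + a) = a] preserves the degree and the bound [W]. *)
have mean (h : nat -> nat) : (forall a b, (a <= b -> h a <= h b)%N) -> h 0%N = 0%N ->
    (forall a, h (a + a) = a)%N -> exists l : 'I_n, forall k, T l k = h (T i k + T j k)%N.
  move=> hmono h0 haa; pose m := of_tails d (fun k => h (T i k + T j k)%N).
  have tm k : tail m k = h (T i k + T j k)%N.
    rewrite tail_of_tails // => l; last by move=> dl; rewrite !T_out.
    by apply: hmono; rewrite leq_add // tail_anti.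
  have [l lm] : exists l : 'I_n, enum_mon l = m.
    apply/enum_monP/HP; rewrite -tail0 tm !T0 haa; split=> // k; rewrite tm -[leqRHS]haa.
    by apply: hmono; rewrite leq_add ?T_le.
  by exists l => k; rewrite /T lm tm.
have [a|lo loP] := mean half (fun a b => @half_leq a b) erefl; first by rewrite addnn doubleK.
have [a|hi hiP] := mean uphalf (fun a b => @uphalf_leq a b) erefl;
  first by rewrite addnn uphalf_double.
by exists lo, hi => k; rewrite loP hiP.
Qed.

(* Sorting a pair makes the first weight drop when two tails differ by at least 2;
   otherwise it replaces the tails by their minima and maxima, which increases the
   sum of the squares of the total tails and so makes the second weight drop. *)
Definition square_weight i : nat := \sum_(k < d) T i k ^ 2.

Definition spread_weight i : nat := (d * N) ^ 2 - (\sum_(k < d) T i k) ^ 2.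

Definition sorting_order : rel 'X_{1..n} :=
  refine (monomial_weight square_weight)
    (refine (monomial_weight spread_weight) (fun a b => (a <= b)%O)).

Lemma sorting_order_monomial : monomial_order sorting_order.
Proof. by do 2!apply: (refine_monomial_order (monomial_weightD _));
  apply: degrevlex_monomial_order. Qed.

Definition weight_lt mu nu : Prop :=
  (monomial_weight square_weight mu < monomial_weight square_weight nu)%N \/
  monomial_weight square_weight mu = monomial_weight square_weight nu /\
  (monomial_weight spread_weight mu < monomial_weight spread_weight nu)%N.

Lemma weight_lt_order mu nu : weight_lt mu nu -> sorting_order mu nu /\ mu <> nu.
Proof.
rewrite /sorting_order /refine; case=> [lt|[-> lt]]; rewrite lt ?eqxx ?orbT; split=> // e;
  by rewrite e ltnn in lt.
Qed.

Lemma sort_pair_weight i j lo hi : ~~ sorted_pair i j ->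
  (forall k, T lo k = (T i k + T j k)./2 /\ T hi k = uphalf (T i k + T j k)) ->
  weight_lt (U_(lo) + U_(hi))%MM (U_(i) + U_(j))%MM.
Proof.
rewrite negb_or => /andP[nij nji] lohi; rewrite /weight_lt !monomial_weightD !monomial_weightU.
have le2 k : (T lo k ^ 2 + T hi k ^ 2 <= T i k ^ 2 + T j k ^ 2)%N.
  by have [-> ->] := lohi k; case: (sum_squares_halves (T i k) (T j k)).
have lt2 k : ~~ ((T i k <= (T j k).+1) && (T j k <= (T i k).+1))%N ->
    (T lo k ^ 2 + T hi k ^ 2 < T i k ^ 2 + T j k ^ 2)%N.
  by have [-> ->] := lohi k; case: (sum_squares_halves (T i k) (T j k)).
have [/forallP close|/forallPn[k far]] :=
  boolP [forall k : 'I_d, (T i k <= (T j k).+1) && (T j k <= (T i k).+1)]%N; last first.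
  left; rewrite /square_weight -!big_split /= (bigD1 k) //= [ltnRHS](bigD1 k) //=.
  by rewrite -addSn leq_add ?lt2 //; apply: leq_sum.
have lo_min k : (T lo k = minn (T i k) (T j k) /\ T hi k = maxn (T i k) (T j k)).
  have [kd|dk] := ltnP k d; last by rewrite !T_out // minnn maxnn.
  have := close (Ordinal kd); have [-> ->] := lohi k => /=; move: (T i k) (T j k) => a b.
  by have := odd_double_half (a + b); rewrite uphalf_half -addnn; case: odd => /=; lia.
right; split.
  rewrite /square_weight -!big_split; apply: eq_bigr => k _ /=.
  by have [-> ->] := lo_min k; case: leqP; lia.
(* When tails differ by at most one, failure of [near_tails a b] means [T b k < T a k] for some [k],
   where the minimum drops. *)
have lt_lo a b : (forall k, T lo k <= T a k)%N -> ~~ near_tails a b ->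
    (forall k, T lo k = minn (T a k) (T b k)) -> (forall k : 'I_d, T b k <= (T a k).+1)%N ->
    (\sum_(k < d) T lo k < \sum_(k < d) T a k)%N.
  move=> loa /forallPn[k nab] lok ba; rewrite (bigD1 k) //= [ltnRHS](bigD1 k) //=.
  by rewrite -addSn leq_add //; [have := lok k; have := ba k; lia | apply: leq_sum].
have lo_i : (\sum_(k < d) T lo k < \sum_(k < d) T i k)%N.
  apply: (lt_lo i j) => // k; [have [] := lo_min k;
    lia | by case: (lo_min k) | by case/andP: (close k)].
have lo_j : (\sum_(k < d) T lo k < \sum_(k < d) T j k)%N.
  by apply: (lt_lo j i) => // k;
    [have [] := lo_min k; lia | rewrite minnC; case: (lo_min k) | case/andP: (close k)].
have sumE : (\sum_(k < d) T lo k + \sum_(k < d) T hi k = \sum_(k < d) T i k + \sum_(k < d) T j k)%N.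
  by rewrite -!big_split; apply: eq_bigr => k _ /=; have [-> ->] := lo_min k; lia.
(* This makes the subtraction in [spread_weight] exact. *)
have bound l : ((\sum_(k < d) T l k) ^ 2 <= (d * N) ^ 2)%N.
  rewrite leq_exp2r // -[X in (X * N)%N]card_ord -sum_nat_const.
  by apply: leq_sum => k _; rewrite -(T0 l) tail_anti.
rewrite /spread_weight; move: (bound lo) (bound hi) (bound i) (bound j) lo_i lo_j sumE.
move: (\sum_(k < d) T lo k)%N (\sum_(k < d) T hi k)%N => a b.
move: (\sum_(k < d) T i k)%N (\sum_(k < d) T j k)%N ((d * N) ^ 2)%N => a' b' M.
move=> ? ? ? ? ? ? ?; have: (a' ^ 2 + b' ^ 2 < a ^ 2 + b ^ 2)%N by nia.
by lia.
Qed.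

Lemma sort_pair_image i j lo hi :
  (forall k, T lo k = (T i k + T j k)./2 /\ T hi k = uphalf (T i k + T j k)) ->
  toric_image (U_(lo) + U_(hi)) = toric_image (U_(i) + U_(j)).
Proof.
move=> lohi; rewrite !toric_imageD !toric_imageU; apply: tail_inj => k.
rewrite !tailD; have [] := lohi k; rewrite /T => -> ->.
by rewrite uphalf_half addnCA addnn odd_double_half.
Qed.

Lemma nonstandard_pair mu : ~ standard mu ->
  exists i j, ~~ sorted_pair i j /\ (U_(i) + U_(j) <= mu)%MM.
Proof.
move=> nstd; have [/existsP[i /existsP[j /and3P[mi mj nij]]]|none] := boolP
    [exists i, [exists j, [&& 0 < mu i, 0 < mu j & ~~ sorted_pair i j]%N]]; last first.
  case: nstd => i j mi mj; apply: contraNT none => nij.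
  by apply/existsP; exists i; apply/existsP; exists j; rewrite mi mj.
(* A generator is sorted with itself, so [i] and [j] differ and exponents of at least 1 suffice. *)
exists i, j; split=> //; have ij : i != j.
  apply: contra nij => /eqP ->; apply/orP; left; apply/near_tailsP => k; lia.
apply/mnm_lepP => k; rewrite mnmDE !mnm1E.
by case: (i =P k) => [ik|_]; case: (j =P k) => [jk|_] //; subst => //; rewrite ?eqxx in ij *.
Qed.

Lemma standard_form mu :
  exists nu, [/\ standard nu, toric_image nu = toric_image mu & sorting_order nu mu].
Proof.
have ord := sorting_order_monomial.
have step nu : ~ standard nu ->
    exists nu', toric_image nu' = toric_image nu /\ weight_lt nu' nu.
  move=> /nonstandard_pair[i [j [nij /submK numu]]]; have [lo [hi lohi]] := sort_pair i j.
  move: (nu - _)%MM numu => r <-; exists (r + (U_(lo) + U_(hi)))%MM.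
  rewrite toric_imageD (sort_pair_image lohi) -toric_imageD; split=> //.
  have := sort_pair_weight nij lohi; rewrite /weight_lt.
  rewrite ![monomial_weight _ (r + _)]monomial_weightD; lia.
(* Lexicographic induction on the two weights. *)
have [a] := ubnP (monomial_weight square_weight mu); elim: a mu => // a IHa mu /ltnSE le_a.
have [b] := ubnP (monomial_weight spread_weight mu);
  elim: b mu le_a => // b IHb mu le_a /ltnSE le_b.
have [|nstd] := boolP [forall i, [forall j, (0 < mu i)%N ==> (0 < mu j)%N ==> sorted_pair i j]].
  move=> /forallP std; exists mu; split=> //; last exact: mo_refl ord mu.
  by move=> i j mi mj; have /forallP/(_ j) := std i; rewrite mi mj.
have [|nu [img lt]] := step mu.
  move=> std; case/negP: nstd; apply/forallP => i; apply/forallP => j.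
  by apply/implyP => mi; apply/implyP => mj; apply: std.
have [nu' [std img' le]] : exists nu',
    [/\ standard nu', toric_image nu' = toric_image nu & sorting_order nu' nu].
  by case: (lt) => [lt1|[eq1 lt1]]; [apply: IHa | apply: IHb]; lia.
exists nu'; split; rewrite ?img' //; apply: mo_trans ord _ _ _ le _.
by case: (weight_lt_order lt).
Qed.

(** Makes [a] the ceiling of the mean of [c] over the factors of [mu]: only [a] and [a - 1] occur,
    and [a] is attained at [i]. *)
Let monomial_weight_bound (c : 'I_n -> nat) mu i a : (0 < mu i)%N ->
  (forall j, 0 < mu j -> c j <= a <= (c j).+1)%N -> c i = a ->
  (monomial_weight c mu <= a * mdeg mu < monomial_weight c mu + mdeg mu)%N.
Proof.
move=> mi ca ci; rewrite mdegE big_distrr /=; apply/andP; split.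
  apply: leq_sum => j _; have [->|/ca/andP[cj _]] := posnP (mu j); first by rewrite !muln0.
  by rewrite leq_mul2r cj orbT.
rewrite /monomial_weight -big_split (bigD1 i) //= [ltnRHS](bigD1 i) //= -addSn leq_add //.
  by rewrite ci -addn1 leq_add2l.
apply: leq_sum => j _; have [->|/ca/andP[_ cj]] := posnP (mu j); first by rewrite !muln0.
by rewrite -mulSnr leq_mul2r cj orbT.
Qed.

(* The largest generator in the support of a standard monomial has tails
   [ceil (t_k / c)], where [t_k] are the tails of the image and [c] the degree. *)
Lemma standard_top mu : standard mu -> mu != 0%MM -> exists2 i, (0 < mu i)%N & forall k,
  (tail (toric_image mu) k <= T i k * mdeg mu < tail (toric_image mu) k + mdeg mu)%N.
Proof.
move=> std mu0; have [i0 mi0] : exists i, (0 < mu i)%N.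
  apply/existsP; apply: contraNT mu0 => /existsPn none; apply/eqP/mnmP => i.
  by rewrite mnm0E; apply/eqP; have := none i; rewrite lt0n negbK.
case: (@arg_maxnP _ i0 (fun i => 0 < mu i)%N (fun i => \sum_(k < d) T i k)%N mi0).
move=> i mi imax; exists i => // k; rewrite tail_toric_image.
apply: (monomial_weight_bound mi) => // j mj.
suff /near_tailsP/(_ k) : near_tails j i by [].
(* In the opposite case [near_tails i j], maximality of the total tail of [i] forces equal tails. *)
have /orP[//|/near_tailsP nij] := std j i mj mi.
have eqT (l : 'I_d) : T i l = T j l.
  have : (\sum_(k < d) T j k <= \sum_(k < d) T i k)%N by apply: imax.
  rewrite (bigD1 l) //= [leqRHS](bigD1 l) //= => le_ji.
  apply/eqP; rewrite eqn_leq; case/andP: (nij l) => -> _ /=.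
  rewrite -(leq_add2r (\sum_(k' < d | k' != l) T i k')); apply: leq_trans le_ji.
  by rewrite leq_add2l; apply: leq_sum => k' _; case/andP: (nij k').
by apply/forallP => l; rewrite eqT leqnn leqnSn.
Qed.

(** As [N > 0], the image determines the degree, and then the top factor as a ceiling; cancel it and
    use induction. *)
Lemma standard_unique mu nu : (0 < N)%N -> standard mu -> standard nu ->
  toric_image mu = toric_image nu -> mu = nu.
Proof.
move=> N_gt0; have deg_image (la : 'X_{1..n}) : mdeg (toric_image la) = (N * mdeg la)%N.
  rewrite -tail0 tail_toric_image mdegE big_distrr; apply: eq_bigr => i _.
  by rewrite -/(T i 0) T0.
have sub_std (la : 'X_{1..n}) i : standard la -> standard (la - U_(i))%MM.
  by move=> std j k; rewrite !mnmBE => ? ?; apply: std; lia.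
have [c] := ubnP (mdeg mu); elim: c mu nu => // c IH mu nu /ltnSE le_c mstd nstd img.
have deg : mdeg mu = mdeg nu by have := congr1 (@mdeg d) img; rewrite !deg_image; nia.
have [mu0|mu0] := eqVneq mu 0%MM.
  by apply/esym/eqP; rewrite mu0 -mdeg_eq0 -deg mu0 mdeg0.
have nu0 : nu != 0%MM by rewrite -mdeg_eq0 -deg mdeg_eq0.
have [i mi iP] := standard_top mstd mu0; have [j nj jP] := standard_top nstd nu0.
have ij : i = j by apply: T_inj => k; have := iP k; have := jP k; rewrite img deg; nia.
subst j; have mE : (mu - U_(i) + U_(i) = mu)%MM by rewrite submK // lep1mP -lt0n.
have nE : (nu - U_(i) + U_(i) = nu)%MM by rewrite submK // lep1mP -lt0n.
rewrite -mE -nE; congr (_ + _)%MM; apply: IH; try exact: sub_std.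
  by have := congr1 (@mdeg n) mE; rewrite mdegD mdeg1; lia.
by apply: (@addIm _ (enum_mon i)); rewrite -toric_imageU -!toric_imageD mE nE.
Qed.

Lemma toric_quadratic_groebner : exists le : rel 'X_{1..n}, monomial_order le /\
  exists B : seq {mpoly K[n]}, groebner_basis le (@toric_ideal K d H) B /\ quadratic B.
Proof.
exists sorting_order; have ord := sorting_order_monomial; split=> //.
(* For [N = 0] the only generator is 1, and standard monomials are not unique in their fiber; the
   basis is then the single binomial ['X_i - 1]. *)
have [N0|N_gt0] := posnP N.
  have H0 m : m \in H -> m = 0%MM by move=> /HP[dm _]; apply/eqP; rewrite -mdeg_eq0 dm N0.
  have zH : 0%MM \in H by apply/HP; rewrite mdeg0; split=> // k; rewrite tail0m.
  have [i iP] := enum_monP zH; have i_unique j : j = i.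
    by apply: enum_mon_inj; rewrite iP (H0 _ (enum_mon_in j)).
  have lead : leading_monomial sorting_order ('X_i - 1 : {mpoly K[n]}) U_(i)%MM.
    rewrite -mpolyX0; apply: leading_monomial_binomial; first exact: mo_refl ord.
      by rewrite mnm1_eq0.
    exact: mo_ge0 ord _.
  exists [:: 'X_i - 1]; split; last first.
    move=> g; rewrite inE => /eqP ->; split; last by rewrite zH.
    apply: leq_trans (mmeasureD_le _ _ _) _; rewrite mmeasureN msizeX msize1 mdeg1.
    by [].
  apply: groebner_basisP => [g|f m fI [mf mmax]].
    rewrite inE => /eqP ->; split; last first.
      by rewrite -msupp_eq0; case: lead => + _; case: msupp.
    rewrite -mpolyX0; apply: toric_ideal_binomial; rewrite toric_imageU iP.
    by rewrite /toric_image big1 // => j _; rewrite mnm0E mulm0n.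
  exists ('X_i - 1); rewrite ?inE //; exists U_(i)%MM => //; rewrite lep1mP.
  (* A leading monomial 1 would leave no room for the second monomial in its fiber. *)
  have [nu [nuf num _]] := toric_ideal_fiber fI mf.
  apply: contra_neqN num => /eqP mi.
  have m0 : m = 0%MM by apply/mnmP => j; rewrite (i_unique j) mi mnm0E.
  by apply: (mo_anti ord); rewrite mmax // m0 mo_ge0.
have /fin_all_exists[lo /fin_all_exists[hi lohi]] (p : 'I_n * 'I_n) := sort_pair p.1 p.2.
pose g p : {mpoly K[n]} := 'X_[U_(p.1) + U_(p.2)] - 'X_[U_(lo p) + U_(hi p)].
pose B := [seq g p | p <- enum [pred p | ~~ sorted_pair p.1 p.2]].
have gB p : ~~ sorted_pair p.1 p.2 -> g p \in B.
  by move=> np; apply: map_f; rewrite mem_enum.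
have lead p : ~~ sorted_pair p.1 p.2 ->
    leading_monomial sorting_order (g p) (U_(p.1) + U_(p.2))%MM.
  move=> np; have [le_p neq_p] := weight_lt_order (sort_pair_weight np (lohi p)).
  by apply: leading_monomial_binomial => //; [exact: mo_refl ord | rewrite eq_sym; apply/eqP].
exists B; split; last first.
  move=> _ /mapP[p _ ->]; split; last first.
    by move=> _; apply: rpredB; rewrite dhomogX /= mdegD !mdeg1.
  apply: leq_trans (mmeasureD_le _ _ _) _; rewrite mmeasureN !msizeX !mdegD !mdeg1.
  by [].
apply: groebner_basisP => [b /mapP[p]|f m fI [mf mmax]].
  rewrite mem_enum => np ->; split; last first.
    by rewrite -msupp_eq0; case: (lead p np) => + _; case: msupp.
  by apply: toric_ideal_binomial; rewrite (sort_pair_image (lohi p)).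
suff /nonstandard_pair[i [j [nij ijm]]] : ~ standard m.
  by exists (g (i, j)); [apply: gB | exists (U_(i) + U_(j))%MM => //; apply: (lead (i, j))].
(* Another monomial [nu] of [f] has the same image; its standard form is [m] by uniqueness, so [m]
   is at most [nu], against the choice of [m] as leading. *)
move=> std; have [nu [nuf num img]] := toric_ideal_fiber fI mf.
have [nu' [std' img' le']] := standard_form nu.
have e : nu' = m by apply: standard_unique => //; rewrite img' img.
by case/eqP: num; apply: (mo_anti ord); rewrite mmax // -e.
Qed.

End Sorting.

Theorem corollary2p5 (K : fieldType) (charK : [pchar K] =i pred0) (d : nat)
    (G : {fset 'X_{1..d}}) (A : {mpoly K[d]} -> Prop)
    (hA : principal_borel_fixed_algebra G A) :
  normal_subring (gauss_algebra (fun i : 'I_#|` G| => 'X_[K, enum_mon i])) /\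
  (exists le : rel 'X_{1..#|` gauss_monomials G|},
     monomial_order le /\
     (exists B : seq {mpoly K[#|` gauss_monomials G|]},
        groebner_basis le (@toric_ideal K d (gauss_monomials G)) B /\
        quadratic B)).
Proof.
have [GB _ _] := hA; have [u GP] := principal_borel_setP charK GB.
have [N [W GaussP]] := gauss_monomials_tail_set GP.
split; last exact: toric_quadratic_groebner GaussP.
exact: cone_algebra_normal (gauss_algebraP charK GaussP).
Qed.
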